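(* Let $\alpha>0$, $\beta\ge0$ and consider the D-ASG iterates $x^{(k+1)}=\mathcal{W}y^{(k)}-\alpha\tilde\nabla F(y^{(k)})$, $y^{(k)}=(1+\beta)x^{(k)}-\beta x^{(k-1)}$, $k\ge0$. Assume there exist $\rho\in(0,1)$ and a positive semi-definite $2\times2$ matrix $\tilde P$ such that $$\rho^2\tilde X_1+(1-\rho^2)\tilde X_2\succeq\begin{bmatrix}\tilde A^T\tilde P\tilde A-\rho^2\tilde P&\tilde A^T\tilde P\tilde B\\ \tilde B^T\tilde P\tilde A&\tilde B^T\tilde P\tilde B\end{bmatrix},$$ where $\tilde A=\begin{bmatrix}1+\beta&-\beta\\1&0\end{bmatrix}$, $\tilde B=\begin{bmatrix}-\alpha\\0\end{bmatrix}$, $$\tilde X_1:=\begin{bmatrix}\frac{\beta^2\mu}{2}&\frac{-\beta^2\mu}{2}&\frac{-\beta}{2}\\ \frac{-\beta^2\mu}{2}&\frac{\beta^2\mu}{2}&\frac{\beta}{2}\\ \frac{-\beta}{2}&\frac{\beta}{2}&\frac{\alpha(1+\lambda_N^W-L\alpha)}{2}\end{bmatrix},\qquad \tilde X_2:=\begin{bmatrix}\frac{(1+\beta)^2\mu}{2}&\frac{-\beta(1+\beta)\mu}{2}&\frac{-(1+\beta)}{2}\\ \frac{-\beta(1+\beta)\mu}{2}&\frac{\beta^2\mu}{2}&\frac{\beta}{2}\\ \frac{-(1+\beta)}{2}&\frac{\beta}{2}&\frac{\alpha(1+\lambda_N^W-L\alpha)}{2}\end{bmatrix}.$$ Let $P=\tilde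 P\otimes I_{Nd}$. Then, for every $k\ge0$, $$\mathbb{E}\left[\|x^{(k)}-x^\infty\|^2\right]\le\rho^{2k}\,\frac{2V_{P,\alpha,1}(\xi_0)}{\mu}+\frac{1}{1-\rho^2}\,\frac{2\alpha^2\sigma^2N}{\mu}\left(\tilde P_{11}+\frac{1-\lambda_N^W+\alpha L}{2\alpha}\right).$$ Therefore $J_\infty:=\frac{1}{\sigma^2N}\limsup_{k\to\infty}\mathrm{Var}(x^{(k)})$ satisfies $$J_\infty\le\frac{2\alpha^2}{\mu(1-\rho^2)}\left(\tilde P_{11}+\frac{1-\lambda_N^W+\alpha L}{2\alpha}\right).$$
   Context: Functions: $f_1,\dots,f_N:\mathbb{R}^d\to\mathbb{R}$ are each $\mu$-strongly convex with $L$-Lipschitz gradient ($0<\mu\le L$). $F:\mathbb{R}^{Nd}\to\mathbb{R}$, $F(x_1,\dots,x_N)=\sum_{i=1}^N f_i(x_i)$. Network: $(\mathcal V,\mathcal E)$ is a connected undirected graph on $\{1,\dots,N\}$; $W$ is a symmetric doubly stochastic $N\times N$ matrix with, for $i\ne j$, $W_{ij}>0$ if $(i,j)\in\mathcal E$ and $W_{ij}=0$ otherwise, and $W_{ii}=1-\sum_{j\neq i}W_{ij}>0$. Its eigenvalues are $1=\lambda_1^W>\lambda_2^W\ge\cdots\ge\lambda_N^W$, and it is assumed that $\lambda_N^W>0$. $\mathcal{W}:=W\otimes I_d$. Iterates: $x^{(k)},y^{(k)}\in\mathbb{R}^{Nd}$ stack the node variables $x_i^{(k)},y_i^{(k)}\in\mathbb{R}^d$;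 $x^{(0)},x^{(-1)}$ are deterministic; $\tilde\nabla F(y^{(k)})$ stacks the stochastic gradients $\tilde\nabla f_i(y_i^{(k)})=\tilde\nabla f_i(y_i^{(k)},w_i^{(k)})$. Noise: $w_i^{(k)}$ is a random variable independent of all $w_j^{(t)}$ with $t<k$ and of $w_j^{(k)}$, $j\neq i$, and $\mathbb{E}[\tilde\nabla f_i(y_i^{(k)},w_i^{(k)})\,|\,y_i^{(k)}]=\nabla f_i(y_i^{(k)})$, $\mathbb{E}[\|\tilde\nabla f_i(y_i^{(k)},w_i^{(k)})-\nabla f_i(y_i^{(k)})\|^2\,|\,y_i^{(k)}]\le\sigma^2$, with $\sigma>0$ where $J_\infty$ is considered. Penalized objective: $F_{\mathcal W,\alpha}(x):=\frac{1}{2\alpha}x^T(I_{Nd}-\mathcal W)x+F(x)$. $x^\infty\in\mathbb{R}^{Nd}$ is its unique minimizer, equivalently the unique solution of $(I_{Nd}-\mathcal W)x^\infty+\alpha\nabla F(x^\infty)=0$. Lyapunov function: $V_{P,\alpha,c}(\xi):=\xi^TP\xi+c\,[F_{\mathcal W,\alpha}(T\xi+x^\infty)-F_{\mathcal W,\alpha}(x^\infty)]$ for $\xi\in\mathbb{R}^{2Nd}$, with $T=[1\ \ 0]\otimes I_{Nd}$; $\xi_0=[(x^{(0)}-x^\infty)^T,(x^{(-1)}-x^\infty)^T]^T$. For a random vector $X$, $\mathrm{Var}(X)=\mathbb{E}\|X-\mathbb{E}X\|^2$. *)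

(* Defs.v *)
From HB Require Import structures.
From mathcomp Require Import all_boot all_order all_algebra.
From mathcomp Require Import mxtens.
From mathcomp Require Import all_classical all_reals all_analysis.

Set Implicit Arguments.
Unset Strict Implicit.
Unset Printing Implicit Defensive.

Import Order.TTheory GRing.Theory Num.Theory.
Import numFieldNormedType.Exports.

Local Open Scope classical_set_scope.
Local Open Scope ring_scope.

Section euclidean.
Context {R : realType}.

Definition dotv n (x y : 'cV[R]_n) : R := (x^T *m y) 0 0.

(* The library norm `|x| on matrices is the sup norm; the Euclidean norm has
   to be introduced separately. *)
Definition sqnorm n (x : 'cV[R]_n) : R := dotv x x.
Definition enorm n (x : 'cV[R]_n) : R := Num.sqrt (sqnorm x).

Definition psdmx n (A : 'M[R]_n) : Prop :=
  A^T = A /\ forall v : 'cV[R]_n, 0 <= (v^T *m A *m v) 0 0.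

Definition grad n (f : 'cV[R]_n -> R) (x : 'cV[R]_n) : 'cV[R]_n :=
  \col_j 'D_(delta_mx j 0) f x.

Definition strongly_convex n (mu : R) (f : 'cV[R]_n -> R) : Prop :=
  forall (x y : 'cV[R]_n) (t : R), 0 <= t -> t <= 1 ->
    f (t *: x + (1 - t) *: y) <=
      t * f x + (1 - t) * f y - mu / 2 * t * (1 - t) * sqnorm (x - y).

Definition lipschitz_gradient n (L : R) (f : 'cV[R]_n -> R) : Prop :=
  (forall x, differentiable f x) /\
  forall x y, enorm (grad f x - grad f y) <= L * enorm (x - y).

Definition unique_minimizer n (f : 'cV[R]_n -> R) (x : 'cV[R]_n) : Prop :=
  forall y, y <> x -> f x < f y.

(* Vectors of R^(m n) made of m blocks of size n, with the index convention of
   the Kronecker product [A *t B]. *)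
Definition stack m n (v : 'I_m -> 'cV[R]_n) : 'cV[R]_(m * n) :=
  \col_p v (@mxtens_unindex m n p).1 (@mxtens_unindex m n p).2 0.

Definition block m n (i : 'I_m) (x : 'cV[R]_(m * n)) : 'cV[R]_n :=
  \col_j x (@mxtens_index m n (i, j)) 0.

End euclidean.

Section network.
Context {R : realType} {N : nat}.

Definition connected_graph (e : rel 'I_N) : Prop :=
  symmetric e /\ forall i j, connect e i j.

Definition doubly_stochastic (W : 'M[R]_N) : Prop :=
  [/\ forall i j, 0 <= W i j,
      forall i, \sum_j W i j = 1 & forall j, \sum_i W i j = 1].

Definition mixing_matrix (e : rel 'I_N) (W : 'M[R]_N) : Prop :=
  [/\ W^T = W, doubly_stochastic W,
      forall i j, i != j -> e i j -> 0 < W i j,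
      forall i j, i != j -> ~~ e i j -> W i j = 0 &
      forall i, W i i = 1 - \sum_(j | j != i) W i j /\ 0 < W i i].

(* Eigenvalues, with multiplicity, in nonincreasing order. *)
Definition ordered_spectrum (W : 'M[R]_N) (lam : N.-tuple R) : Prop :=
  char_poly W = \prod_(a <- lam) ('X - a%:P) /\ sorted >=%R lam.

Context {d : nat}.

Definition kronW (W : 'M[R]_N) : 'M[R]_(N * d) := W *t (1%:M : 'M[R]_d).

Definition sum_obj (f : 'I_N -> 'cV[R]_d -> R) (x : 'cV[R]_(N * d)) : R :=
  \sum_i f i (block i x).

Definition penalized (W : 'M[R]_N) (al : R) (f : 'I_N -> 'cV[R]_d -> R)
    (x : 'cV[R]_(N * d)) : R :=
  (2 * al)^-1 * (x^T *m (1%:M - kronW W) *m x) 0 0 + sum_obj f x.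

(* T = [1 0] (x) I_{Nd}; the cast identifies 1 * (N d) with N d. *)
Definition Tmx : 'M[R]_(N * d, 2 * (N * d)) :=
  castmx (mul1n (N * d)%N, erefl (2 * (N * d))%N)
    ((delta_mx 0 0 : 'rV[R]_2) *t (1%:M : 'M[R]_(N * d))).

Definition lyapunov (W : 'M[R]_N) (al : R) (f : 'I_N -> 'cV[R]_d -> R)
    (xinf : 'cV[R]_(N * d)) (P : 'M[R]_(2 * (N * d))) (c : R)
    (xi : 'cV[R]_(2 * (N * d))) : R :=
  (xi^T *m P *m xi) 0 0 +
  c * (penalized W al f (Tmx *m xi + xinf) - penalized W al f xinf).

Definition xi_pair (u v : 'cV[R]_(N * d)) : 'cV[R]_(2 * (N * d)) :=
  stack (fun i : 'I_2 => if i == 0 then u else v).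

End network.

Section lmi.
Context {R : realType}.

Definition mx_of_rows m n (s : seq (seq R)) : 'M[R]_(m, n) :=
  \matrix_(i, j) nth 0 (nth [::] s i) j.

Definition Atilde (be : R) : 'M[R]_2 :=
  mx_of_rows 2 2 [:: [:: 1 + be; - be]; [:: 1; 0]].

Definition Btilde (al : R) : 'cV[R]_2 := mx_of_rows 2 1 [:: [:: - al]; [:: 0]].

Definition X1tilde (al be mu L lamN : R) : 'M[R]_3 := mx_of_rows 3 3
  [:: [:: be ^+ 2 * mu / 2; - be ^+ 2 * mu / 2; - be / 2];
      [:: - be ^+ 2 * mu / 2; be ^+ 2 * mu / 2; be / 2];
      [:: - be / 2; be / 2; al * (1 + lamN - L * al) / 2]].

Definition X2tilde (al be mu L lamN : R) : 'M[R]_3 := mx_of_rows 3 3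
  [:: [:: (1 + be) ^+ 2 * mu / 2; - be * (1 + be) * mu / 2; - (1 + be) / 2];
      [:: - be * (1 + be) * mu / 2; be ^+ 2 * mu / 2; be / 2];
      [:: - (1 + be) / 2; be / 2; al * (1 + lamN - L * al) / 2]].

Definition LMI_rhs (al be rho : R) (Pt : 'M[R]_2) : 'M[R]_3 :=
  block_mx
    ((Atilde be)^T *m Pt *m Atilde be - rho ^+ 2 *: Pt)
    ((Atilde be)^T *m Pt *m Btilde al)
    ((Btilde al)^T *m Pt *m Atilde be)
    ((Btilde al)^T *m Pt *m Btilde al).

Definition LMI (al be mu L lamN rho : R) (Pt : 'M[R]_2) : Prop :=
  psdmx (rho ^+ 2 *: X1tilde al be mu L lamN
         + (1 - rho ^+ 2) *: X2tilde al be mu L lamN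
         - LMI_rhs al be rho Pt).

End lmi.

Section iterates.
Context {R : realType} {n : nat}.
Variables (Wk : 'M[R]_n) (al be : R) (G : nat -> 'cV[R]_n -> 'cV[R]_n).
Variables x0 xm1 : 'cV[R]_n.

Definition extrapolate (s : 'cV[R]_n * 'cV[R]_n) : 'cV[R]_n :=
  (1 + be) *: s.1 - be *: s.2.

(* The pair (x^(k), x^(k-1)), started from (x^(0), x^(-1)); [G k] is the
   gradient estimate used at step k. *)
Fixpoint asg_state (k : nat) : 'cV[R]_n * 'cV[R]_n :=
  if k is k'.+1 then
    let s := asg_state k' in
    let y := extrapolate s in
    (Wk *m y - al *: G k' y, s.1)
  else (x0, xm1).

Definition asg_x (k : nat) := (asg_state k).1.
Definition asg_y (k : nat) := extrapolate (asg_state k).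

End iterates.

(* R^n with its Borel sigma-algebra. *)
Definition borel_cV (R : realType) (n : nat) :=
  g_sigma_algebraType (@open 'cV[R]_n).

Section probability_notions.
Context {dO : measure_display} {Omega : measurableType dO} {R : realType}.
Variable P : probability Omega R.

Definition sigma_of (dT : measure_display) (T : measurableType dT)
    (X : Omega -> T) : set (set Omega) :=
  preimage_set_system setT X measurable.

(* [Z] is a version of E[X | G]. *)
Definition is_cond_exp (G : set (set Omega)) (X Z : Omega -> R) : Prop :=
  [/\ P.-integrable setT (EFin \o X),
      P.-integrable setT (EFin \o Z),
      (forall B : set R, measurable B -> G (Z @^-1` B)) &
      (forall A, G A ->
         \int[P]_(w in A) (X w)%:E = \int[P]_(w in A) (Z w)%:E)%E].

Definition is_cond_exp_vec n (G : set (set Omega)) (X Z : Omega -> 'cV[R]_n) :=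
  forall j, is_cond_exp G (fun w => X w j 0) (fun w => Z w j 0).

Definition cond_exp_le (G : set (set Omega)) (X : Omega -> R) (c : R) : Prop :=
  exists Z, is_cond_exp G X Z /\ {ae P, forall w, Z w <= c}.

Definition independent_sigma (G H : set (set Omega)) : Prop :=
  forall A B, G A -> H B -> P (A `&` B) = (P A * P B)%E.

Definition mean_vec n (X : Omega -> 'cV[R]_n) : 'cV[R]_n :=
  \col_j fine ('E_P[fun w => X w j 0]).

Definition Var n (X : Omega -> 'cV[R]_n) : \bar R :=
  ('E_P[fun w => sqnorm (X w - mean_vec X)])%E.

Definition Jinf n (N : nat) (sigma : R) (x : nat -> Omega -> 'cV[R]_n) : \bar R :=
  (((sigma ^+ 2 * N%:R)^-1)%:E * limn_esup (fun k => Var (x k)))%E.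

End probability_notions.

Section noise.
Context {dO : measure_display} {Omega : measurableType dO} {R : realType}.
Context {N d : nat} {dS : 'I_N -> measure_display}.
Context {S : forall i, measurableType (dS i)}.
Variable P : probability Omega R.
Variable w : nat -> forall i : 'I_N, Omega -> S i.

(* sigma-algebra generated jointly by the w_j^(t), t < k, and the w_j^(k),
   j <> i. *)
Definition other_noise (k : nat) (i : 'I_N) : set (set Omega) :=
  <<s \bigcup_(p in [set p : nat * 'I_N |
                      (p.1 < k)%N \/ (p.1 = k /\ p.2 <> i)])
        sigma_of (w p.1 p.2) >>.

Definition noise_independent : Prop :=
  forall k i, independent_sigma P (sigma_of (w k i)) (other_noise k i).

(* The stochastic gradient [g i] is applied to the i-th block only. *)
Definition stoch_grad (g : forall i : 'I_N, 'cV[R]_d -> S i -> 'cV[R]_d)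
    (om : Omega) (k : nat) (y : 'cV[R]_(N * d)) : 'cV[R]_(N * d) :=
  stack (fun i => g i (block i y) (w k i om)).

Definition oracle_measurable
    (g : forall i : 'I_N, 'cV[R]_d -> S i -> 'cV[R]_d) : Prop :=
  forall i, measurable_fun setT
    (fun p : borel_cV R d * S i => g i p.1 p.2 : borel_cV R d).

(* E[g_i(y_i,w_i) | y_i] = grad f_i(y_i) and
   E[||g_i(y_i,w_i) - grad f_i(y_i)||^2 | y_i] <= sigma^2 along the given
   sequence of random points y^(k). *)
Definition noise_moments (f : 'I_N -> 'cV[R]_d -> R)
    (g : forall i : 'I_N, 'cV[R]_d -> S i -> 'cV[R]_d) (sigma : R)
    (y : nat -> Omega -> 'cV[R]_(N * d)) : Prop :=
  forall k i,
    let yi := fun om => block i (y k om) in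
    let Gi := sigma_of (yi : Omega -> borel_cV R d) in
    is_cond_exp_vec P Gi (fun om => g i (yi om) (w k i om))
                         (fun om => grad (f i) (yi om)) /\
    cond_exp_le P Gi
      (fun om => sqnorm (g i (yi om) (w k i om) - grad (f i) (yi om)))
      (sigma ^+ 2).

Definition dasg_x (W : 'M[R]_N) (al be : R) g x0 xm1 (k : nat) (om : Omega) :=
  asg_x (kronW W : 'M[R]_(N * d)) al be (stoch_grad g om) x0 xm1 k.

Definition dasg_y (W : 'M[R]_N) (al be : R) g x0 xm1 (k : nat) (om : Omega) :=
  asg_y (kronW W : 'M[R]_(N * d)) al be (stoch_grad g om) x0 xm1 k.

End noise.

(* Main.v *)
(** Up to the noise, [x^(k+1) = y - al G] where [G] is the gradient of the
    penalized objective [Phi] at [y].  Strong convexity of [Phi] at [y], against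
    [x^(k)] with weight [rho^2] and against [xinf] with weight [1 - rho^2], and
    the descent inequality from [y] turn the LMI, applied to each coordinate of
    [(x^(k) - xinf, x^(k-1) - xinf, G)], into a one-step contraction of the
    Lyapunov function, up to a term linear in the noise [eps] and
    [al^2 C |eps|^2].  By Fubini, independence upgrades the hypothesis
    [E[eps_i | y_i] = 0] to orthogonality of [eps_i] to every square-integrable
    function of the past, so the linear term has mean zero; the constant term is
    at most [al^2 C sigma^2 N] and the recursion is geometric. *)
Require Import Defs.
From HB Require Import structures.
From mathcomp Require Import all_boot all_order all_algebra.
From mathcomp Require Import mxtens.
From mathcomp Require Import all_classical all_reals all_analysis.

From mathcomp Require complex spectral sesquilinear.
From mathcomp Require Import measurable_realfun.
From mathcomp Require Import ring lra zify.

Set Implicit Arguments.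
Unset Strict Implicit.
Unset Printing Implicit Defensive.

Import Order.TTheory GRing.Theory Num.Theory.
Import numFieldNormedType.Exports.

Local Open Scope classical_set_scope.
Local Open Scope ring_scope.

(** * Smooth strongly convex functions *)

(** No moment of the iterates is assumed, so integrability is propagated together with the bound.
    The growth [mu/2 |x - xinf|^2 <= V], also the origin of the factor [2/mu], puts [x^(k)] in L^2
    as soon as [V] is integrable; the linear growth of the gradients then puts the coefficient of
    [eps] in L^2, and the one-step inequality dominates the next value of [V]. That coefficient
    depends on [x^(k)], [x^(k-1)] and all blocks of [y], so it is not a function of the block [y_i]
    on which the oracle hypotheses condition; this is what independence has to repair. Its use
    requires the iterates to be measurable for the sigma-algebra of the other noise, not only on
    [Omega]. With [K = (1 - lambda_N + al L) / (2 al)], half the smoothness constant of [Phi], one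
    has [C = Pt 0 0 + K]: one share of [|eps|^2] comes from the quadratic form, the other from the
    descent inequality. *)

Section euclid.
Context {R : realType}.

Lemma dotvE n (x y : 'cV[R]_n) : dotv x y = \sum_j x j 0 * y j 0.
Proof. by rewrite /dotv mxE; apply: eq_bigr => j _; rewrite mxE. Qed.

Lemma dotvC n (x y : 'cV[R]_n) : dotv x y = dotv y x.
Proof. by rewrite !dotvE; apply: eq_bigr => j _; rewrite mulrC. Qed.

Lemma dotvDr n (x y z : 'cV[R]_n) : dotv x (y + z) = dotv x y + dotv x z.
Proof. by rewrite /dotv mulmxDr mxE. Qed.

Lemma dotvDl n (x y z : 'cV[R]_n) : dotv (x + y) z = dotv x z + dotv y z.
Proof. by rewrite dotvC dotvDr ![dotv z _]dotvC. Qed.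

Lemma dotvZr n a (x y : 'cV[R]_n) : dotv x (a *: y) = a * dotv x y.
Proof. by rewrite /dotv -scalemxAr mxE. Qed.

Lemma dotvZl n a (x y : 'cV[R]_n) : dotv (a *: x) y = a * dotv x y.
Proof. by rewrite dotvC dotvZr dotvC. Qed.

Lemma dotvNr n (x y : 'cV[R]_n) : dotv x (- y) = - dotv x y.
Proof. by rewrite /dotv mulmxN mxE. Qed.

Lemma dotvNl n (x y : 'cV[R]_n) : dotv (- x) y = - dotv x y.
Proof. by rewrite dotvC dotvNr dotvC. Qed.

Lemma sqnormE n (x : 'cV[R]_n) : sqnorm x = \sum_j x j 0 ^+ 2.
Proof. by rewrite /sqnorm dotvE; apply: eq_bigr => j _; rewrite expr2. Qed.

Lemma sqnorm_ge0 n (x : 'cV[R]_n) : 0 <= sqnorm x.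
Proof. by rewrite sqnormE sumr_ge0// => j _; rewrite sqr_ge0. Qed.

Lemma sqnormZ n a (x : 'cV[R]_n) : sqnorm (a *: x) = a ^+ 2 * sqnorm x.
Proof. by rewrite /sqnorm dotvZl dotvZr mulrA expr2. Qed.

Lemma enorm_ge0 n (x : 'cV[R]_n) : 0 <= enorm x.
Proof. exact: sqrtr_ge0. Qed.

Lemma enorm_sqr n (x : 'cV[R]_n) : enorm x ^+ 2 = sqnorm x.
Proof. by rewrite /enorm sqr_sqrtr// sqnorm_ge0. Qed.

(** Cauchy-Schwarz: the squared norm of [|y|^2 x - <x,y> y] equals
    [|y|^2 (|x|^2 |y|^2 - <x,y>^2)]. *)
Lemma dotv_le n (x y : 'cV[R]_n) : dotv x y <= enorm x * enorm y.
Proof.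
have [y0|y0] := eqVneq (sqnorm y) 0.
  have : y = 0.
    apply/colP => j; rewrite mxE; move: y0; rewrite sqnormE => /eqP.
    rewrite psumr_eq0 => [/allP/(_ j)|i _]; last exact: sqr_ge0.
    by rewrite mem_index_enum sqrf_eq0 => /(_ isT)/eqP.
  by move=> ->; rewrite /dotv mulmx0 mxE mulr_ge0// enorm_ge0.
have y1 : 0 < sqnorm y by rewrite lt0r y0 sqnorm_ge0.
apply: (@le_trans _ _ `|dotv x y|); first exact: ler_norm.
rewrite -(@ler_pXn2r _ 2)// ?nnegrE ?mulr_ge0 ?enorm_ge0//.
rewrite exprMn !enorm_sqr real_normK ?num_real//.
have := sqnorm_ge0 (sqnorm y *: x - dotv x y *: y).
rewrite /sqnorm !(dotvDl, dotvDr, dotvNl, dotvNr, dotvZl, dotvZr) -!/(sqnorm _).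
rewrite (dotvC y x) => h.
rewrite -(ler_pM2l y1); nra.
Qed.

Lemma derive_grad n (f : 'cV[R]_n -> R) (x h : 'cV[R]_n) :
  differentiable f x -> 'D_h f x = dotv (grad f x) h.
Proof.
move=> df; rewrite deriveE// [in LHS](_ : h = \sum_j h j 0 *: delta_mx j 0).
  rewrite linear_sum dotvE; apply: eq_bigr => j _.
  by rewrite linearZ/= !mxE deriveE// mulrC.
by rewrite [LHS]matrix_sum_delta; apply: eq_bigr => i _; rewrite big_ord1.
Qed.

Lemma is_derive_line n (f : 'cV[R]_n -> R) (x h : 'cV[R]_n) (t : R) :
  differentiable f (x + t *: h) ->
  is_derive t 1 (fun s => f (x + s *: h)) (dotv (grad f (x + t *: h)) h).
Proof.
move=> df; set z := x + t *: h.
have /cvg_ex[l hl] : derivable f z h by apply: diff_derivable.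
have Dh : 'D_h f z = l by apply/cvg_lim.
rewrite -derive_grad// Dh.
have H : (fun u : R => u^-1 *: (f (x + (u *: (1:R) + t) *: h) - f (x + t *: h)))
   @ 0^' --> l.
  apply: cvg_trans hl; apply: near_eq_cvg; near=> u.
  rewrite /z /=; congr (_ *: (f _ - _)).
  by rewrite -[u *: 1]/(u * 1) mulr1 scalerDl addrCA.
by split; [apply/cvg_ex; exists l|apply/cvg_lim].
Unshelve. all: by end_near.
Qed.

(** Strong convexity at [x + u (y - x)], divided by [u], as [u] tends to 0 from the right. *)
Lemma strongly_convex_grad n (mu : R) (f : 'cV[R]_n -> R) (x y : 'cV[R]_n) :
  strongly_convex mu f -> differentiable f x ->
  f x + dotv (grad f x) (y - x) + mu / 2 * sqnorm (y - x) <= f y.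
Proof.
move=> sc df; set h := y - x; set S := sqnorm h.
have df0 : differentiable f (x + 0 *: h) by rewrite scale0r addr0.
have [/cvg_ex[l hl] dl] := is_derive_line df0.
have {}dl : dotv (grad f x) h = l.
  by move: dl; rewrite scale0r addr0 => <-; exact/cvg_lim.
rewrite dl.
suff : l <= f y - f x - mu / 2 * S by lra.
have hr : (f y - f x - mu / 2 * (1 - u) * S) @[u --> 0^'+] -->
    (f y - f x - mu / 2 * S).
  have -> : f y - f x - mu / 2 * S = f y - f x - mu / 2 * (1 - 0) * S.
    by rewrite subr0 mulr1.
  apply: cvg_at_right_filter.
  apply: cvgB; first exact: cvg_cst.
  apply: cvgMl; apply: cvgMr; apply: cvgB; [exact: cvg_cst|exact: cvg_id].
apply: (ler_cvg_to (cvg_dnbhs_at_right hl) hr).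
near=> u => /=.
have u0 : 0 < u by near: u; exact: nbhs_right_gt.
have u1 : u < 1 by near: u; exact: nbhs_right_lt.
have := sc y x u (ltW u0) (ltW u1).
rewrite -[u *: 1]/(u * 1) mulr1 addr0 scale0r addr0.
have -> : u *: y + (1 - u) *: x = x + u *: h.
  by rewrite /h scalerBl scalerBr scale1r addrCA.
rewrite -/h -/S => H.
rewrite -[X in X <= _]/(u^-1 * (f (x + u *: h) - f x)) -(ler_pM2l u0) mulrA divff ?gt_eqF//.
nra.
Unshelve. all: by end_near.
Qed.

(** Instead of integrating the gradient along the segment, the quadratic model is subtracted: by
    Cauchy-Schwarz the difference [phi] has nonpositive derivative on [[0, 1]], so
    [phi 1 <= phi 0]. *)
Lemma lipschitz_descent n (L : R) (f : 'cV[R]_n -> R) (x h : 'cV[R]_n) :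
  0 <= L -> lipschitz_gradient L f ->
  f (x + h) <= f x + dotv (grad f x) h + L / 2 * sqnorm h.
Proof.
move=> L0 [df lf].
pose phi (t : R) := f (x + t *: h) - t * dotv (grad f x) h - L / 2 * t ^+ 2 * sqnorm h.
have dphi (t : R) : is_derive t 1 phi
    (dotv (grad f (x + t *: h)) h - dotv (grad f x) h - L * t * sqnorm h).
  have d1 := is_derive_line (df (x + t *: h)).
  rewrite /phi; apply: is_derive_eq.
  set D := dotv (grad f (x + t *: h)) h; rewrite /GRing.scale/=.
  by field.
have cphi (t : R) : {for t, continuous phi}.
  have [d _] := dphi t.
  by apply: differentiable_continuous; apply/derivable1_diffP.
have : phi 1 <= phi 0.
  apply: (@ler0_derive1_nincr R phi 0 1) => //.
  - move=> t; rewrite in_itv/= => /andP[t0 _].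
    rewrite derive1E; have [_ ->] := dphi t.
    rewrite -dotvNl -dotvDl.
    apply: (le_trans (_ : _ <= L * t * sqnorm h - L * t * sqnorm h)); last by rewrite subrr.
    rewrite lerD2r; apply: le_trans (dotv_le _ _) _.
    have := lf (x + t *: h) x.
    have -> : x + t *: h - x = t *: h by rewrite addrC addKr.
    have -> : enorm (t *: h) = t * enorm h.
      by rewrite /enorm sqnormZ sqrtrM ?sqr_ge0// sqrtr_sqr gtr0_norm.
    rewrite -enorm_sqr; have := enorm_ge0 h; nra.
  - by apply: continuous_subspaceT => t; exact: cphi.
rewrite /phi scale0r addr0 scale1r expr0n/= !mul0r mulr0 expr1n; lra.
Qed.
End euclid.

(** * Kronecker products and the spectrum of the mixing matrix *)

Section quad.
Context {R : realType}.

Lemma quadE n (A : 'M[R]_n) (x : 'cV[R]_n) :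
  (x^T *m A *m x) 0 0 = \sum_i \sum_j A i j * (x i 0 * x j 0).
Proof.
rewrite mxE exchange_big/=; apply: eq_bigr => j _.
rewrite mxE big_distrl/=; apply: eq_bigr => i _.
by rewrite mxE mulrAC mulrC mulrA.
Qed.

Lemma sum_tens (V : nmodType) m n (F : 'I_(m * n) -> V) :
  \sum_p F p = \sum_i \sum_j F (mxtens_index (i, j)).
Proof.
rewrite pair_big/= (reindex (@mxtens_index m n)); first by apply: eq_bigr => -[].
by exists (@mxtens_unindex m n) => ? _; [exact: mxtens_indexK|exact: mxtens_unindexK].
Qed.

(* The transpose of [block]: the [j]-th coordinate of every node. *)
Definition slice m n (j : 'I_n) (x : 'cV[R]_(m * n)) : 'cV[R]_m :=
  \col_i x (mxtens_index (i, j)) 0.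

(** Serves both Kronecker products of the problem: the mixing matrix with [I_d] and [Pt] with
    [I_{Nd}]. *)
Lemma quad_tens m n (A : 'M[R]_m) (x : 'cV[R]_(m * n)) :
  (x^T *m (A *t (1%:M : 'M[R]_n)) *m x) 0 0 =
  \sum_j ((slice j x)^T *m A *m slice j x) 0 0.
Proof.
rewrite quadE sum_tens exchange_big/=; apply: eq_bigr => j _.
rewrite quadE; apply: eq_bigr => i _.
rewrite sum_tens; apply: eq_bigr => i' _.
rewrite (bigD1 j)//= big1 => [|j' jj'].
  by rewrite tensmxE !mxE eqxx mulr1 addr0.
by rewrite tensmxE !mxE eq_sym (negbTE jj') mulr0 mul0r.
Qed.

Lemma sqnorm_slice m n (x : 'cV[R]_(m * n)) :
  sqnorm x = \sum_j sqnorm (slice j x).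
Proof.
rewrite sqnormE sum_tens exchange_big/=; apply: eq_bigr => j _.
by rewrite sqnormE; apply: eq_bigr => i _; rewrite mxE.
Qed.

Lemma sqnorm_block m n (x : 'cV[R]_(m * n)) :
  sqnorm x = \sum_i sqnorm (block i x).
Proof.
rewrite sqnormE sum_tens; apply: eq_bigr => j _.
by rewrite sqnormE; apply: eq_bigr => i _; rewrite mxE.
Qed.

Lemma dotv_block m n (x y : 'cV[R]_(m * n)) :
  dotv x y = \sum_i dotv (block i x) (block i y).
Proof.
rewrite dotvE sum_tens; apply: eq_bigr => j _.
by rewrite dotvE; apply: eq_bigr => i _; rewrite !mxE.
Qed.

Lemma block_stack m n (v : 'I_m -> 'cV[R]_n) i : block i (stack v) = v i.
Proof. by apply/colP => j; rewrite !mxE mxtens_indexK. Qed.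

End quad.

Section spectrum.
Import complex spectral sesquilinear.
Context {R : realType}.

(* The spectral theorem is only available over a numClosedFieldType, so [W] is
   diagonalized over [R[i]]. *)
Lemma sym_eigenvalue_lb n (W : 'M[R]_n) (s : seq R) (l : R) :
  W^T = W -> char_poly W = \prod_(a <- s) ('X - a%:P) ->
  (forall a, a \in s -> l <= a) ->
  forall v : 'cV[R]_n, l * sqnorm v <= (v^T *m W *m v) 0 0.
Proof.
move=> Wsym Wchar ls v.
pose r2c := real_complex R : {rmorphism R -> R[i]}.
pose Wc := map_mx r2c W.
have conjr a : (r2c a)^* = r2c a by by apply/CrealP/complex_realP; exists a.
have Wh : Wc \is hermsymmx.
  apply/is_hermitianmxP; rewrite expr0 scale1r.
  apply/matrixP => i j; rewrite !mxE conjr -[in LHS]Wsym mxE //.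
have /hermitian_normalmx/orthomx_spectralP := Wh.
set P := spectralmx Wc; set D := spectral_diag Wc => WE.
have PU : P \is unitarymx := spectral_unitarymx Wc.
have Pu := unitarymx_unit PU.
(* Row [i] of the invertible [P] is a left eigenvector for [D 0 i], which is therefore a root of the
   characteristic polynomial and belongs to [s]. *)
have Di i : exists2 a, a \in s & D 0 i = r2c a.
  have : eigenvalue Wc (D 0 i).
    apply/eigenvalueP; exists (row i P).
      rewrite -row_mul WE !mulmxA mulmxV// mul1mx.
      by rewrite mul_diag_mx; apply/rowP => j; rewrite !mxE.
    apply/eqP => r0; have := row_mul i P (invmx P).
    rewrite mulmxV// r0 mul0mx => /rowP/(_ i).
    by rewrite !mxE eqxx => /eqP; rewrite oner_eq0.
  rewrite eigenvalue_root_char -map_char_poly Wchar rmorph_prod/=.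
  under eq_bigr do rewrite map_polyXsubC.
  rewrite -(big_map _ xpredT (fun a => 'X - a%:P)) root_prod_XsubC.
  by move=> /mapP[a sa ->]; exists a.
(* In the coordinates [u = P v] the form is the sum of [D_i |u_i|^2] and the norm the sum of
   [|u_i|^2], so the bound holds term by term. *)
pose vc := map_mx r2c v; have [u uP] : exists u, u = P *m vc by eexists.
have uE : map_mx Num.conj u^T = vc^T *m invmx P.
  rewrite uP invmx_unitary// trmx_mul map_mxM; congr (_ *m _).
  by apply/matrixP => i j; rewrite !mxE; exact: conjr.
have quad1 : r2c ((v^T *m W *m v) 0 0) = \sum_i D 0 i * `|u i 0| ^+ 2.
  transitivity ((map_mx r2c (v^T *m W *m v)) 0 0); first by rewrite [RHS]mxE.
  rewrite !map_mxM -/Wc -/vc -map_trmx -/vc WE !mulmxA -uE -mulmxA -uP.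
  rewrite mxE; apply: eq_bigr => i _.
  by rewrite mul_mx_diag !mxE normCK mulrAC mulrC [_^* * _]mulrC.
have quad2 : r2c (sqnorm v) = \sum_i `|u i 0| ^+ 2.
  transitivity ((map_mx r2c (v^T *m v)) 0 0); first by rewrite [RHS]mxE.
  have -> : map_mx r2c (v^T *m v) = map_mx Num.conj u^T *m u.
    by rewrite uE uP mulmxA mulmxKV// map_mxM map_trmx.
  by rewrite mxE; apply: eq_bigr => i _; rewrite !mxE normCK mulrC.
have : r2c (l * sqnorm v) <= r2c ((v^T *m W *m v) 0 0).
  rewrite rmorphM/= quad1 quad2 mulr_sumr; apply: ler_sum => i _.
  rewrite ler_wpM2r ?exprn_ge0//; have [a sa ->] := Di i.
  by rewrite /r2c/= lecR ls.
by rewrite /r2c/= lecR.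
Qed.

End spectrum.

Section mixing.
Context {R : realType} {N : nat}.

Lemma quad_subl1 (W : 'M[R]_N) (v : 'cV[R]_N) :
  (v^T *m (1%:M - W) *m v) 0 0 = sqnorm v - (v^T *m W *m v) 0 0.
Proof.
rewrite mulmxBr mulmx1 mulmxBl /sqnorm /dotv.
by set A := v^T *m v; set B := v^T *m W *m v; rewrite !mxE.
Qed.

(** Dirichlet form of the weighted graph. After expansion each of the two families of squares sums
    to [|v|^2], by the row sums and the symmetry of [W]. *)
Lemma laplacian_quad (W : 'M[R]_N) (v : 'cV[R]_N) :
  W^T = W -> (forall i, \sum_j W i j = 1) ->
  (v^T *m (1%:M - W) *m v) 0 0 =
    2^-1 * \sum_i \sum_j W i j * (v i 0 - v j 0) ^+ 2.
Proof.
move=> Wsym W1.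
have Wtr i j : W i j = W j i by rewrite -[in LHS]Wsym mxE.
have s1 : \sum_i \sum_j W i j * (v i 0) ^+ 2 = sqnorm v.
  by rewrite sqnormE; apply: eq_bigr => i _; rewrite -mulr_suml W1 mul1r.
have s2 : \sum_i \sum_j W i j * (v j 0) ^+ 2 = sqnorm v.
  by rewrite -s1 exchange_big/=; apply: eq_bigr => i _; apply: eq_bigr => j _; rewrite Wtr.
rewrite quad_subl1 quadE.
under [X in _ = _ * X]eq_bigr => i _.
  under eq_bigr => j _.
    have -> : W i j * (v i 0 - v j 0) ^+ 2 = W i j * v i 0 ^+ 2 + W i j * v j 0 ^+ 2
       - (W i j * (v i 0 * v j 0)) *+ 2 by ring.
    over.
  rewrite sumrB big_split/= sumrMnl; over.
rewrite sumrB big_split/= s1 s2 sumrMnl; lra.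
Qed.

Lemma mixing_quad_ge0 (e : rel 'I_N) (W : 'M[R]_N) (v : 'cV[R]_N) :
  mixing_matrix e W -> 0 <= (v^T *m (1%:M - W) *m v) 0 0.
Proof.
case=> Ws [W0 W1 _] _ _ _; rewrite laplacian_quad// mulr_ge0 ?invr_ge0//.
by rewrite sumr_ge0// => i _; rewrite sumr_ge0// => j _; rewrite mulr_ge0 ?sqr_ge0.
Qed.

(** Entries are numbered from 0, so [lambda_N] has index [N.-1]; it is the least one because the
    list is nonincreasing. *)
Lemma ordered_spectrum_lb (W : 'M[R]_N) (lam : N.-tuple R) (v : 'cV[R]_N) :
  W^T = W -> ordered_spectrum W lam ->
  lam`_N.-1 * sqnorm v <= (v^T *m W *m v) 0 0.
Proof.
move=> Ws [Wc slam]; apply: (sym_eigenvalue_lb Ws Wc) => a /(nthP 0)[i].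
rewrite size_tuple => iN <-.
apply: (sorted_leq_nth ge_trans ge_refl 0 slam); rewrite ?inE ?size_tuple//; lia.
Qed.

Lemma mixing_quad_le (W : 'M[R]_N) (lam : N.-tuple R) (v : 'cV[R]_N) :
  W^T = W -> ordered_spectrum W lam ->
  (v^T *m (1%:M - W) *m v) 0 0 <= (1 - lam`_N.-1) * sqnorm v.
Proof.
move=> Ws Wl; have := ordered_spectrum_lb v Ws Wl.
rewrite quad_subl1; lra.
Qed.

(** At the all-ones vector the two bounds on the Laplacian form give [0 <= (1 - lambda_N) N]. This
    yields the nonnegativity of the noise constant. *)
Lemma lamN_le1 (e : rel 'I_N) (W : 'M[R]_N) (lam : N.-tuple R) : (0 < N)%N ->
  mixing_matrix e W -> ordered_spectrum W lam -> lam`_N.-1 <= 1.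
Proof.
move=> N0 hW hl; case: (hW) => Ws [_ W1 _] _ _ _.
pose v : 'cV[R]_N := const_mx 1.
have := le_trans (mixing_quad_ge0 v hW) (mixing_quad_le v Ws hl).
have -> : sqnorm v = N%:R.
  rewrite sqnormE (eq_bigr (fun=> 1)) => [|i _]; last by rewrite mxE expr1n.
  by rewrite sumr_const card_ord.
by rewrite pmulr_lge0 ?ltr0n// subr_ge0.
Qed.

End mixing.

(** If [b < a], the value [t = 1/2] forces [a > 0]; then [t = (a - b) / (2 a)] is admissible and
    makes [(1 - t) a] the midpoint of [a] and [b], which exceeds [b]. *)
Lemma le_of_lt1_mul {R : realFieldType} (a b : R) :
  (forall t, 0 < t -> t < 1 -> (1 - t) * a <= b) -> a <= b.
Proof.
move=> h; rewrite leNgt; apply/negP => ba.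
have h2 : a / 2 <= b by have := h 2^-1; lra.
have a0 : 0 < a by lra.
have := h ((a - b) / (2 * a)).
have -> : (1 - (a - b) / (2 * a)) * a = (a + b) / 2 by field; rewrite gt_eqF.
rewrite divr_gt0 ?ltr_pdivrMr ?mulr_gt0 ?subr_gt0//; lra.
Qed.

(** * The penalized objective and the one-step inequality *)

Section quad_add.
Context {R : realType}.

Lemma quad_add n (A : 'M[R]_n) (x h : 'cV[R]_n) : A^T = A ->
  ((x + h)^T *m A *m (x + h)) 0 0 =
  (x^T *m A *m x) 0 0 + 2 * dotv (A *m x) h + (h^T *m A *m h) 0 0.
Proof.
move=> As.
have E : (h^T *m A *m x) 0 0 = (x^T *m A *m h) 0 0.
  have <- : (h^T *m A *m x)^T = x^T *m A *m h by rewrite !trmx_mul trmxK As mulmxA.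
  by rewrite [RHS]mxE.
have F : dotv (A *m x) h = (x^T *m A *m h) 0 0 by rewrite /dotv trmx_mul As.
rewrite F [(x + h)^T]linearD/= !mulmxDl !mulmxDr; move: E.
set a := x^T *m A *m x; set b := x^T *m A *m h; set c := h^T *m A *m x.
by set k := h^T *m A *m h; clearbody a b c k => E; rewrite !mxE E; lra.
Qed.
End quad_add.

Section objective.
Context {R : realType} {N d : nat}.
Variables (f : 'I_N -> 'cV[R]_d -> R).

Lemma blockD i (x y : 'cV[R]_(N * d)) : block i (x + y) = block i x + block i y.
Proof. by apply/colP => j; rewrite !mxE. Qed.

Lemma blockN i (x : 'cV[R]_(N * d)) : block i (- x) = - block i x.
Proof. by apply/colP => j; rewrite !mxE. Qed.

Definition stack_grad (y : 'cV[R]_(N * d)) : 'cV[R]_(N * d) :=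
  stack (fun i => grad (f i) (block i y)).

Lemma sum_obj_strongly_convex (mu : R) (x y : 'cV[R]_(N * d)) :
  (forall i, strongly_convex mu (f i)) -> (forall i z, differentiable (f i) z) ->
  sum_obj f x + dotv (stack_grad x) (y - x) + mu / 2 * sqnorm (y - x) <= sum_obj f y.
Proof.
move=> sc df; rewrite /sum_obj sqnorm_block dotv_block mulr_sumr -!big_split/=.
apply: ler_sum => i _; rewrite block_stack blockD blockN.
exact: strongly_convex_grad.
Qed.

Lemma sum_obj_descent (L : R) (x h : 'cV[R]_(N * d)) :
  0 <= L -> (forall i, lipschitz_gradient L (f i)) ->
  sum_obj f (x + h) <= sum_obj f x + dotv (stack_grad x) h + L / 2 * sqnorm h.
Proof.
move=> L0 lf; rewrite /sum_obj sqnorm_block dotv_block mulr_sumr -!big_split/=.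
apply: ler_sum => i _; rewrite block_stack blockD.
exact: lipschitz_descent.
Qed.

Variables (e : rel 'I_N) (W : 'M[R]_N) (lam : N.-tuple R) (al mu L : R).
Hypotheses (hW : mixing_matrix e W) (hlam : ordered_spectrum W lam).
Hypotheses (hal : 0 < al) (hmu : 0 < mu) (hL0 : 0 <= L).
Hypothesis hsc : forall i, strongly_convex mu (f i).
Hypothesis hL : forall i, lipschitz_gradient L (f i).
Let lamN := lam`_N.-1.
Let Lap : 'M[R]_(N * d) := 1%:M - kronW W.
Let Phi := penalized W al f.

(** Makes the Laplacian a single Kronecker product, to which [quad_tens] applies. *)
Lemma kron_laplacian : Lap = (1%:M - W) *t (1%:M : 'M[R]_d).
Proof.
apply/matrixP => p q.
case: (mxtens_indexP p) => i j; case: (mxtens_indexP q) => i' j'.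
rewrite /Lap /kronW [LHS]mxE [X in _ + X]mxE !tensmxE !mxE mulrBl; congr (_ - _).
rewrite (inj_eq (can_inj (@mxtens_indexK _ _))) xpair_eqE.
by case: (i == i'); case: (j == j'); rewrite /= ?mulr1 ?mulr0 ?mul0r.
Qed.

Lemma Lap_sym : Lap^T = Lap.
Proof.
have [Ws _ _ _ _] := hW.
by rewrite kron_laplacian trmx_tens linearB/= Ws !trmx1.
Qed.

Lemma Lap_quad_ge0 (x : 'cV[R]_(N * d)) : 0 <= (x^T *m Lap *m x) 0 0.
Proof.
by rewrite kron_laplacian quad_tens sumr_ge0// => j _; exact: mixing_quad_ge0 hW.
Qed.

Lemma Lap_quad_le (x : 'cV[R]_(N * d)) :
  (x^T *m Lap *m x) 0 0 <= (1 - lamN) * sqnorm x.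
Proof.
have [Ws _ _ _ _] := hW.
rewrite kron_laplacian quad_tens sqnorm_slice mulr_sumr ler_sum// => j _.
exact: mixing_quad_le.
Qed.

(** The gradient of [Phi], given by formula: only the two inequalities below are used, so [Phi] is
    never differentiated. *)
Definition pen_grad (y : 'cV[R]_(N * d)) : 'cV[R]_(N * d) :=
  stack_grad y + al^-1 *: (Lap *m y).

(** The quadratic part expands exactly; its second-order remainder is nonnegative and dropped, which
    leaves the modulus [mu] of the sum of the [f i]. *)
Lemma penalized_strongly_convex (x y : 'cV[R]_(N * d)) :
  Phi x + dotv (pen_grad x) (y - x) + mu / 2 * sqnorm (y - x) <= Phi y.
Proof.
have := sum_obj_strongly_convex x y hsc (fun i => (hL i).1).
have := quad_add x (y - x) Lap_sym; rewrite addrC subrK => qy.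
rewrite /Phi /penalized -/Lap qy /pen_grad dotvDl dotvZl.
have := Lap_quad_ge0 (y - x).
set q := _ 0 0; set q2 := _ 0 0; set D := dotv (_ *m _) _ => q0 h.
have : 0 <= (2 * al)^-1 * q by rewrite mulr_ge0// invr_ge0 mulr_ge0// ltW.
have -> : (2 * al)^-1 * (q2 + 2 * D + q) =
   (2 * al)^-1 * q2 + al^-1 * D + (2 * al)^-1 * q by field; rewrite gt_eqF.
lra.
Qed.

(** Same expansion, the remainder now bounded through [lambda_N]. The constant is half of
    [(1 - lambda_N) / al + L]. *)
Lemma penalized_descent (x h : 'cV[R]_(N * d)) :
  Phi (x + h) <= Phi x + dotv (pen_grad x) h +
    (1 - lamN + al * L) / (2 * al) * sqnorm h.
Proof.
have := sum_obj_descent x h hL0 hL.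
have := quad_add x h Lap_sym => qy.
rewrite /Phi /penalized -/Lap qy /pen_grad dotvDl dotvZl.
have := Lap_quad_le h.
set q := _ 0 0; set q2 := _ 0 0; set D := dotv (_ *m _) _ => q0 h1.
have : (2 * al)^-1 * q <= (2 * al)^-1 * ((1 - lamN) * sqnorm h).
  by rewrite ler_pM2l// invr_gt0 mulr_gt0.
have -> : (2 * al)^-1 * (q2 + 2 * D + q) =
   (2 * al)^-1 * q2 + al^-1 * D + (2 * al)^-1 * q by field; rewrite gt_eqF.
have -> : (1 - lamN + al * L) / (2 * al) * sqnorm h =
   (2 * al)^-1 * ((1 - lamN) * sqnorm h) + L / 2 * sqnorm h by field; rewrite gt_eqF.
lra.
Qed.

(** Obtained without a stationarity condition at [xinf]. Strong convexity at
    [z = xinf + t (x - xinf)], towards [x] with weight [t] and towards [xinf] with weight [1 - t],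
    cancels the gradient terms and leaves [t (1 - t) mu/2 |x - xinf|^2]; with [Phi xinf <= Phi z],
    divide by [t] and let [t] tend to 0. *)
Lemma penalized_growth (xinf x : 'cV[R]_(N * d)) :
  unique_minimizer Phi xinf -> mu / 2 * sqnorm (x - xinf) <= Phi x - Phi xinf.
Proof.
move=> hmin; apply: le_of_lt1_mul => t t0 t1.
pose z := xinf + t *: (x - xinf).
have zx : x - z = (1 - t) *: (x - xinf).
  by rewrite /z scalerBl scale1r opprD addrA.
have zi : xinf - z = - t *: (x - xinf).
  by rewrite /z opprD addrA subrr add0r scaleNr.
have h1 := penalized_strongly_convex z x.
have h2 := penalized_strongly_convex z xinf.
have h3 : Phi xinf <= Phi z.
  by have [->//|/eqP zn] := eqVneq z xinf; exact/ltW/hmin.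
move: h1 h2; rewrite zx zi !dotvZr !sqnormZ.
set S := sqnorm _; set D := dotv _ _ => h1 h2.
rewrite -(ler_pM2l t0).
have h1' : 0 <= t * (Phi x - (Phi z + (1 - t) * D + mu / 2 * ((1 - t) ^+ 2 * S))).
  by rewrite mulr_ge0 ?subr_ge0// ltW.
have h2' : 0 <= (1 - t) * (Phi xinf - (Phi z + - t * D + mu / 2 * ((- t) ^+ 2 * S))).
  by rewrite mulr_ge0 ?subr_ge0// ltW.
lra.
Qed.

End objective.

(** * The matrix inequality as an inequality between quadratic forms *)

Section lmi_quad.
Context {R : realType}.

(** For symmetric [Pt], the value at the stacked pair [(a, b)] of the form with matrix [Pt] tensored
    with the identity. *)
Definition qform2 (Pt : 'M[R]_2) n (a b : 'cV[R]_n) : R :=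
  Pt 0 0 * sqnorm a + 2 * Pt 0 1 * dotv a b + Pt 1 1 * sqnorm b.

Lemma quad2 (Pt : 'M[R]_2) (v : 'cV[R]_2) : Pt^T = Pt ->
  (v^T *m Pt *m v) 0 0 =
  Pt 0 0 * v 0 0 ^+ 2 + 2 * Pt 0 1 * (v 0 0 * v 1 0) + Pt 1 1 * v 1 0 ^+ 2.
Proof.
move=> Ps; have P10 : Pt 1 0 = Pt 0 1 by rewrite -[in LHS]Ps mxE.
rewrite quadE !big_ord_recl !big_ord0 /=.
have -> : lift (0 : 'I_2) (0 : 'I_1) = 1 by apply/val_inj.
rewrite P10; ring.
Qed.

Definition qscalar (Pt : 'M[R]_2) (u v : R) : R :=
  Pt 0 0 * u ^+ 2 + 2 * Pt 0 1 * (u * v) + Pt 1 1 * v ^+ 2.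

(** The LMI evaluated at [(a, b, g)]. [X1tilde] encodes the strong convexity terms for
    [y - x = be (a - b)], [X2tilde] those for [y - xinf = (1 + be) a - be b], and the block matrix
    the change of the [Pt]-form in one noiseless step. *)
Lemma LMI_scalar (al be mu L l rho : R) (Pt : 'M[R]_2) (a b g : R) :
  Pt^T = Pt -> LMI al be mu L l rho Pt ->
  qscalar Pt ((1 + be) * a - be * b - al * g) a - rho ^+ 2 * qscalar Pt a b <=
  rho ^+ 2 * (be ^+ 2 * mu / 2 * (a - b) ^+ 2 - be * (a - b) * g)
  + (1 - rho ^+ 2) * (mu / 2 * ((1 + be) * a - be * b) ^+ 2
       - ((1 + be) * a - be * b) * g)
  + al * (1 + l - L * al) / 2 * g ^+ 2.
Proof.
move=> Ps [_ LM].
set a' := _ - al * g.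
pose Q := qscalar Pt; rewrite -/Q.
pose u : 'cV[R]_2 := mx_of_rows 2 1 [:: [:: a]; [:: b]].
pose w : 'cV[R]_1 := g%:M.
set A := Atilde be; set B := Btilde al.
(* The size is written [2 + 1] so that the block product lemmas apply; it is convertible to 3. *)
pose M : 'M[R]_(2 + 1) := block_mx (A^T *m Pt *m A - rho ^+ 2 *: Pt)
  (A^T *m Pt *m B) (B^T *m Pt *m A) (B^T *m Pt *m B).
have rhsE : ((col_mx u w)^T *m M *m col_mx u w) 0 0 = Q a' a - rho ^+ 2 * Q a b.
  pose z := A *m u + B *m w.
  have -> : (col_mx u w)^T *m M *m col_mx u w =
     z^T *m Pt *m z - rho ^+ 2 *: (u^T *m Pt *m u).
    rewrite tr_col_mx /M mul_row_block mul_row_col /z.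
    rewrite [(_ + _)^T]linearD/= !trmx_mul.
    rewrite !(mulmxDl, mulmxDr, mulmxN, mulNmx, mulmxA) -!scalemxAr -!scalemxAl.
    by rewrite -!addrA; congr (_ + _); rewrite [LHS]addrC !addrA.
  have za : z 0 0 = a'.
    rewrite /z /A /B /u /w mul_mx_scalar !mxE !big_ord_recl big_ord0/= !mxE/= /a'; ring.
  have zb : z 1 0 = a.
    rewrite /z /A /B /u /w mul_mx_scalar !mxE !big_ord_recl big_ord0/= !mxE/=; ring.
  have ua : u 0 0 = a by rewrite mxE.
  have ub : u 1 0 = b by rewrite mxE.
  rewrite mxE [X in _ + X]mxE [X in _ - X]mxE !quad2// za zb ua ub.
  by [].
have := LM (col_mx u w : 'cV[R]_3); rewrite mulmxBr mulmxBl.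
set X := rho ^+ 2 *: _ + _; pose v : 'cV[R]_3 := col_mx u w; rewrite -/v.
have vE i : v i 0 = nth 0 [:: a; b; g] i.
  rewrite /v mxE; case: splitP => j ->.
    by rewrite mxE; case: j => [[|[|]]].
  by rewrite !mxE !ord1.
have XE : (v^T *m X *m v) 0 0 =
  rho ^+ 2 * (be ^+ 2 * mu / 2 * (a - b) ^+ 2 - be * (a - b) * g)
  + (1 - rho ^+ 2) * (mu / 2 * ((1 + be) * a - be * b) ^+ 2
       - ((1 + be) * a - be * b) * g)
  + al * (1 + l - L * al) / 2 * g ^+ 2.
  rewrite quadE !big_ord_recl !big_ord0 !vE/= !mxE/=.
  by field.
have -> : (v^T *m X *m v - v^T *m LMI_rhs al be rho Pt *m v) 0 0 =
    (v^T *m X *m v) 0 0 - (Q a' a - rho ^+ 2 * Q a b).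
  by rewrite -rhsE; set Y := v^T *m X *m v; rewrite mxE [X in _ + X]mxE.
by rewrite XE subr_ge0.
Qed.
End lmi_quad.

Section one_step.
Context {R : realType}.

(** Every term is a sum over coordinates, so the scalar inequality is summed and the LMI is never
    tensored with the identity. *)
Lemma LMI_vec (al be mu L l rho : R) (Pt : 'M[R]_2) n (a b g : 'cV[R]_n) :
  Pt^T = Pt -> LMI al be mu L l rho Pt ->
  qform2 Pt ((1 + be) *: a - be *: b - al *: g) a - rho ^+ 2 * qform2 Pt a b <=
  rho ^+ 2 * (be ^+ 2 * mu / 2 * sqnorm (a - b) - be * dotv (a - b) g)
  + (1 - rho ^+ 2) * (mu / 2 * sqnorm ((1 + be) *: a - be *: b)
       - dotv ((1 + be) *: a - be *: b) g)
  + al * (1 + l - L * al) / 2 * sqnorm g.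
Proof.
move=> Ps hL.
have qE (x y : 'cV[R]_n) : qform2 Pt x y = \sum_i qscalar Pt (x i 0) (y i 0).
  by rewrite /qform2 !sqnormE dotvE !mulr_sumr -!big_split.
rewrite !qE !sqnormE !dotvE !mulr_sumr -!sumrB !mulr_sumr -!big_split/=.
apply: ler_sum => i _; have := LMI_scalar (a i 0) (b i 0) (g i 0) Ps hL.
rewrite !mxE; lra.
Qed.

Context {N d : nat}.

Lemma Tmx_xi_pair (u v : 'cV[R]_(N * d)) : Tmx *m xi_pair u v = u.
Proof.
apply/colP => p; rewrite mxE sum_tens (bigD1 0)//= (bigD1 p)//=.
have TE i j : Tmx p (mxtens_index (i, j)) = (i == 0)%:R * (p == j)%:R :> R.
  rewrite /Tmx castmxE/=.
  have -> : cast_ord (esym (mul1n (N * d))) p = mxtens_index (0 : 'I_1, p).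
    exact/val_inj.
  by rewrite cast_ord_id tensmxE !mxE eqxx.
rewrite TE !eqxx !mulr1 mul1r mxE mxtens_indexK/= !big1 ?addr0 // => [i i0|j jp].
  by rewrite big1// => j _; rewrite TE (negbTE i0) !mul0r.
by rewrite TE [p == j]eq_sym (negbTE jp) mulr0 mul0r.
Qed.

Lemma slice_xi_pair (u v : 'cV[R]_(N * d)) j (i : 'I_2) :
  slice j (xi_pair u v) i 0 = (if i == 0 then u else v) j 0.
Proof. by rewrite mxE /xi_pair mxE mxtens_indexK. Qed.

Lemma lyapunovE (W : 'M[R]_N) al (f : 'I_N -> 'cV[R]_d -> R) xinf (Pt : 'M[R]_2) u v :
  Pt^T = Pt ->
  lyapunov W al f xinf (Pt *t (1%:M : 'M[R]_(N * d))) 1 (xi_pair u v) =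
  qform2 Pt u v + (penalized W al f (u + xinf) - penalized W al f xinf).
Proof.
move=> Ps; rewrite /lyapunov Tmx_xi_pair mul1r quad_tens; congr (_ + _).
rewrite /qform2 !sqnormE dotvE !mulr_sumr -!big_split/=.
apply: eq_bigr => j _; rewrite quad2// !slice_xi_pair/=; ring.
Qed.

Section descent.
Variables (f : 'I_N -> 'cV[R]_d -> R) (e : rel 'I_N) (W : 'M[R]_N).
Variables (lam : N.-tuple R) (al be mu L rho : R) (Pt : 'M[R]_2).
Hypotheses (hW : mixing_matrix e W) (hlam : ordered_spectrum W lam).
Hypotheses (hal : 0 < al) (hmu : 0 < mu) (hL0 : 0 <= L).
Hypothesis hsc : forall i, strongly_convex mu (f i).
Hypothesis hL : forall i, lipschitz_gradient L (f i).
Hypotheses (hrho : 0 < rho < 1) (Ps : Pt^T = Pt).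
Hypothesis hLMI : LMI al be mu L lam`_N.-1 rho Pt.
Variable xinf : 'cV[R]_(N * d).
Let Phi := penalized W al f.
Let K := (1 - lam`_N.-1 + al * L) / (2 * al).

(** The Lyapunov function with [c = 1], in the unshifted variables [x^(k)], [x^(k-1)]; [lyapunovE]
    makes the link. *)
Definition Vfun (x xm : 'cV[R]_(N * d)) : R :=
  qform2 Pt (x - xinf) (xm - xinf) + (Phi x - Phi xinf).

(* The coefficient of the noise in the expansion of [Vfun] at the next iterate. *)
Definition noise_dir (x xm : 'cV[R]_(N * d)) : 'cV[R]_(N * d) :=
  let y := extrapolate be (x, xm) in
  let g := pen_grad f W al y in
  (- (2 * al) * Pt 0 0) *: (y - xinf - al *: g) +
  (- (2 * al) * Pt 0 1) *: (x - xinf) +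
  (2 * K * al ^+ 2 - al) *: g.

Lemma one_step (x xm eps : 'cV[R]_(N * d)) :
  Vfun (kronW W *m extrapolate be (x, xm)
        - al *: (stack_grad f (extrapolate be (x, xm)) + eps)) x <=
  rho ^+ 2 * Vfun x xm + dotv (noise_dir x xm) eps
  + al ^+ 2 * (Pt 0 0 + K) * sqnorm eps.
Proof.
rewrite /noise_dir.
have [y ydef] : exists y, y = extrapolate be (x, xm) by eexists.
rewrite -ydef; pose g := pen_grad f W al y.
(* Since [al g = al grad F(y) + (I - W) y], mixing followed by a gradient step on [F] is a gradient
   step on [Phi]. *)
have -> : kronW W *m y - al *: (stack_grad f y + eps) = y - al *: g - al *: eps.
  rewrite /g /pen_grad !scalerDr scalerA divff ?gt_eqF// scale1r mulmxBl mul1mx.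
  set z := kronW W *m y; set s := stack_grad f y.
  by clearbody z s; apply/colP => i; rewrite !mxE; ring.
pose a := x - xinf; pose b := xm - xinf.
have yE : y - xinf = (1 + be) *: a - be *: b.
  by apply/colP => i; rewrite ydef /extrapolate /a /b !mxE; ring.
have yx : y - x = be *: (a - b).
  by apply/colP => i; rewrite ydef /extrapolate /a /b !mxE; ring.
have H1 := penalized_strongly_convex hW hal hsc hL y x.
have H2 := penalized_strongly_convex hW hal hsc hL y xinf.
have H3 := penalized_descent hW hlam hal hL0 hL y (- (al *: g + al *: eps)).
have H4 := LMI_vec a b g Ps hLMI.
move: H1 H2 H3 H4; rewrite -/g -/Phi -/K opprD addrA.
have -> : x - y = - (be *: (a - b)) by rewrite -opprB yx.
have -> : xinf - y = - ((1 + be) *: a - be *: b) by rewrite -opprB yE.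
rewrite /Vfun -/g -/a -/b.
have -> : y - al *: g - al *: eps - xinf = (y - xinf - al *: g) - al *: eps.
  by apply/colP => i; rewrite !mxE; ring.
rewrite yE; set c := (1 + be) *: a - be *: b.
rewrite /qform2 /sqnorm.
(* The corner entry of the LMI is exactly the decrease of [|g|^2] that the descent inequality
   provides. *)
have -> : al * (1 + lam`_N.-1 - L * al) / 2 = al - K * al ^+ 2.
  by rewrite /K; field; rewrite gt_eqF.
clearbody K c g; set h := a - b; clearbody h; clearbody a b.
rewrite !(dotvDl, dotvDr, dotvNl, dotvNr, dotvZl, dotvZr).
rewrite (dotvC g c) (dotvC g h) (dotvC eps c) (dotvC eps g) (dotvC eps a).
move=> H1 H2 H3 H4.
have [r0 r1] := andP hrho.
have r2 : 0 <= 1 - rho ^+ 2 by rewrite subr_ge0 expr_le1// ltW.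
(* With weights [rho^2] and [1 - rho^2] the values [Phi y] add up to one copy, which the descent
   inequality cancels; what remains is linear in the inner products. *)
move: H1; rewrite -subr_ge0 => /(mulr_ge0 (sqr_ge0 rho)) H1.
move: H2; rewrite -subr_ge0 => /(mulr_ge0 r2) H2.
lra.
Qed.
End descent.
End one_step.

(** * Measurability of the iterates *)

Section borel_vectors.
Context {R : realType}.

Lemma continuous_measurable_cV n (h : 'cV[R]_n -> R) :
  continuous h -> measurable_fun setT (h : borel_cV R n -> R).
Proof.
move=> /continuousP ch; apply: (measurability _ (measurable_realfun.RGenOpens.measurableE R)).
move=> _ [_ [a [b ->] <-]]; rewrite setTI.
by apply: sub_sigma_algebra; apply: ch; exact: interval_open.
Qed.

Lemma measurable_coord n (j : 'I_n) :
  measurable_fun setT (fun x : borel_cV R n => (x : 'cV[R]_n) j 0).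
Proof. by apply: continuous_measurable_cV; exact: coord_continuous. Qed.

(* Second countability: the balls have rational centers and radii [1/(k+1)]. *)
Lemma open_cV_bigcup n (U : set 'cV[R]_n) : open U ->
  U = \bigcup_(q : 'cV[rat]_n * nat)
    [set x | (forall y : 'cV[R]_n, (forall j, `|ratr (q.1 j 0) - y j 0| < q.2.+1%:R^-1) -> U y) /\
             forall j, `|ratr (q.1 j 0) - x j 0| < q.2.+1%:R^-1].
Proof.
move=> oU; apply/seteqP; split => [x Ux|x [q _ [/= qU]]]; last exact: qU.
have /nbhs_ballP[eps/= eps0 xU] : nbhs x U by exact: open_nbhs_nbhs.
(* With radius below [eps / 2], a box whose center is that close to [x] stays within [eps] of
   [x]. *)
have [k hk] : exists k : nat, k.+1%:R^-1 < eps / 2.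
  have e2 : 0 < eps / 2 by rewrite divr_gt0.
  near \oo => k; exists k; near: k; exact: near_infty_natSinv_lt (PosNum e2).
pose dl : R := k.+1%:R^-1; have dl0 : 0 < dl by rewrite invr_gt0.
have hq (j : 'I_n) : {q : rat | `|ratr q - x j 0| < dl}.
  apply: cid; have /rat_in_itvoo[q] : x j 0 - dl < x j 0 + dl by lra.
  by rewrite in_itv/= => /andP[h1 h2]; exists q; rewrite ltr_norml; lra.
exists (\col_j sval (hq j), k) => //=; split => [y hy|j]; last first.
  by rewrite mxE; exact: svalP (hq j).
apply: xU; split => // i j; rewrite ord1 -ball_normE /ball_/=.
have := hy i; have := svalP (hq i); rewrite mxE -/dl.
set q := ratr _ => h1 h2.
have -> : x i 0 - y i 0 = (q - y i 0) - (q - x i 0) by ring.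
apply: le_lt_trans (ler_normB _ _) _; rewrite -/dl in hk; lra.
Unshelve. all: by end_near.
Qed.

(** The Borel sigma-algebra is generated by open sets, not by coordinates. In the countable
    decomposition the clause [A] does not involve the point [t], so each piece has preimage either
    empty or a finite intersection of coordinate conditions. *)
Lemma measurable_cV d (T : measurableType d) n (h : T -> 'cV[R]_n) :
  (forall j, measurable_fun setT (fun t => h t j 0)) ->
  measurable_fun setT (h : T -> borel_cV R n).
Proof.
move=> mh; apply: (@measurability _ _ T (borel_cV R n) setT h (@open 'cV[R]_n)) => // _ [U oU <-].
rewrite setTI (open_cV_bigcup oU) preimage_bigcup.
apply: countable_bigcupT_measurable => [|q]; first exact: countableP.
set A := forall y : 'cV[R]_n, _.
have [a|na] := pselect A; last first.
  by rewrite (_ : _ @^-1` _ = set0)//; apply/seteqP; split => t [].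
rewrite (_ : _ @^-1` _ = \bigcap_(j in [set: 'I_n])
    [set t | `|ratr (q.1 j 0) - h t j 0| < q.2.+1%:R^-1]); last first.
  by apply/seteqP; split => [t [_ ht] j _|t ht]; [exact: ht|split => // j; exact: ht].
apply: fin_bigcap_measurable => // j _.
rewrite -[X in measurable X]setTI.
apply: (measurable_fun_ltr (f := fun t => `|ratr (q.1 j 0) - h t j 0|) (g := cst _)) => //.
by apply: measurableT_comp => //; apply: measurable_funB.
Qed.
End borel_vectors.

Section iterates_measurable.
Context {R : realType} {N d : nat} {dT : measure_display} {T : measurableType dT}.
Context {dS : 'I_N -> measure_display} {S : forall i, measurableType (dS i)}.
Variables (w : nat -> forall i : 'I_N, T -> S i).
Variables (g : forall i : 'I_N, 'cV[R]_d -> S i -> 'cV[R]_d).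
Hypothesis hg : oracle_measurable g.

Lemma measurable_lin n (c1 c2 : R) (x y : T -> 'cV[R]_n) :
  (forall j, measurable_fun setT (fun t => x t j 0)) ->
  (forall j, measurable_fun setT (fun t => y t j 0)) ->
  forall j, measurable_fun setT (fun t => (c1 *: x t + c2 *: y t) j 0).
Proof.
move=> mx my j; under eq_fun do rewrite !mxE.
by apply: measurable_funD; apply: measurable_funM.
Qed.

Lemma measurable_mulmx m n (A : 'M[R]_(m, n)) (x : T -> 'cV[R]_n) :
  (forall j, measurable_fun setT (fun t => x t j 0)) ->
  forall j, measurable_fun setT (fun t => (A *m x t) j 0).
Proof.
move=> mx j; under eq_fun do rewrite !mxE.
by apply: measurable_sum => i; apply: measurable_funM.
Qed.

Lemma measurable_block (x : T -> 'cV[R]_(N * d)) i :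
  (forall j, measurable_fun setT (fun t => x t j 0)) ->
  forall j, measurable_fun setT (fun t => block i (x t) j 0).
Proof. by move=> mx j; under eq_fun do rewrite mxE; exact: mx. Qed.

Lemma measurable_extrapolate be (s : T -> 'cV[R]_(N * d) * 'cV[R]_(N * d)) :
  (forall j, measurable_fun setT (fun t => (s t).1 j 0)) ->
  (forall j, measurable_fun setT (fun t => (s t).2 j 0)) ->
  forall j, measurable_fun setT (fun t => extrapolate be (s t) j 0).
Proof.
move=> m1 m2 j; rewrite /extrapolate; under eq_fun do rewrite -scaleNr.
exact: measurable_lin.
Qed.

(** The measurable structure on [T] is arbitrary and only the noise before step [k] has to be
    measurable for it: the lemma serves for [Omega] and for the smaller sigma-algebra
    [other_noise]. *)
Lemma asg_state_measurable (A : 'M[R]_(N * d)) al be x0 xm1 k :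
  (forall t i, (t < k)%N -> measurable_fun setT (w t i)) ->
  forall j,
    measurable_fun setT (fun om => (asg_state A al be (stoch_grad w g om) x0 xm1 k).1 j 0) /\
    measurable_fun setT (fun om => (asg_state A al be (stoch_grad w g om) x0 xm1 k).2 j 0).
Proof.
elim: k => [_ j|k IH mw j]; first by split => /=.
have {}IH := IH (fun t i tk => mw t i (ltnW tk)).
split; last exact: (IH j).1.
have my := measurable_extrapolate be (fun j => (IH j).1) (fun j => (IH j).2).
rewrite /=; under eq_fun do rewrite -scaleNr -[_ *m _]scale1r.
apply: measurable_lin => {}j; first exact: measurable_mulmx.
under eq_fun do rewrite mxE.
set i := (mxtens_unindex j).1; set l := (mxtens_unindex j).2.
have mp : measurable_fun setT (fun om => (block i (extrapolate be
    (asg_state A al be (stoch_grad w g om) x0 xm1 k)) : borel_cV R d, w k i om)).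
  apply: measurable_fun_pair; last exact: mw.
  by apply: measurable_cV => l'; exact: measurable_block.
exact: (measurableT_comp (measurableT_comp (measurable_coord l) (@hg i)) mp).
Qed.
End iterates_measurable.

(** * Independence and orthogonality *)

Section joint_law.
Local Open Scope ereal_scope.
Context d1 d2 dO (T1 : measurableType d1) (T2 : measurableType d2)
  (Omega : measurableType dO) (R : realType) (P : probability Omega R).
Variables (X : {mfun Omega >-> T1}) (Y : {mfun Omega >-> T2}).
Hypothesis indep : forall A B, measurable A -> measurable B ->
  P (X @^-1` A `&` Y @^-1` B) = P (X @^-1` A) * P (Y @^-1` B).

Let XY om := (X om, Y om).

Let mXY : measurable_fun setT XY.
Proof. exact: measurable_fun_pair. Qed.

HB.instance Definition _ := isMeasurableFun.Build _ _ _ _ XY mXY.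

Let m1 : probability T1 R := distribution P X.
Let m2 : probability T2 R := distribution P Y.

(** Independence says that the two measures agree on rectangles, which determines the product
    measure. *)
Let joint_lawE (A : set (T1 * T2)) : measurable A ->
  (m1 \x m2) A = distribution P XY A.
Proof.
by move=> mA; apply: product_measure_unique.
Qed.

Lemma indep_integrable (phi : T1 * T2 -> \bar R) : measurable_fun setT phi ->
  P.-integrable setT (fun om => phi (X om, Y om)) ->
  (m1 \x m2).-integrable setT phi.
Proof.
move=> mphi iphi.
have /integrableP[_ h] := integrable_pushforward mXY mphi iphi measurableT.
apply/integrableP; split => //; apply: le_lt_trans h.
by rewrite (eq_measure_integral (distribution P XY))// => A mA _; exact: joint_lawE.
Qed.

Lemma indep_integral (phi : T1 * T2 -> \bar R) : measurable_fun setT phi ->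
  P.-integrable setT (fun om => phi (X om, Y om)) ->
  \int[m1]_x \int[m2]_y phi (x, y) = \int[P]_om phi (X om, Y om).
Proof.
move=> mphi iphi.
have -> := integral12_prod_meas1 (indep_integrable mphi iphi).
rewrite (eq_measure_integral (distribution P XY)) => [|A mA _]; last exact: joint_lawE.
by rewrite integral_distribution.
Qed.
End joint_law.

Section orthogonality.
Local Open Scope ereal_scope.
Context d1 d2 dO (T1 : measurableType d1) (T2 : measurableType d2)
  (Omega : measurableType dO) (R : realType) (P : probability Omega R).
Variables (Z : Omega -> R) (X : Omega -> T1) (Y : Omega -> T2).
Hypotheses (mZ : measurable_fun setT Z) (mX : measurable_fun setT X)
  (mY : measurable_fun setT Y).
Hypothesis indep : forall (A : set (R * T1)) B, measurable A -> measurable B ->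
  P ((fun om => (Z om, X om)) @^-1` A `&` Y @^-1` B) =
  P ((fun om => (Z om, X om)) @^-1` A) * P (Y @^-1` B).

HB.instance Definition _ := isMeasurableFun.Build _ _ _ _ X mX.
HB.instance Definition _ := isMeasurableFun.Build _ _ _ _ Y mY.

Let ZX om := (Z om, X om).
Let mZX : measurable_fun setT ZX. Proof. exact: measurable_fun_pair. Qed.
HB.instance Definition _ := isMeasurableFun.Build _ _ _ _ ZX mZX.

(** [Y] is independent of the pair [(Z, X)], not just of [X]: Fubini on [(Z, X)] and [Y] turns the
    integral into that of [Z q(X)], where [q(X) = 0] almost surely. *)
Lemma indep_orthogonal (phi : T1 * T2 -> R) : measurable_fun setT phi ->
  P.-integrable setT (fun om => (phi (X om, Y om))%:E) ->
  P.-integrable setT (fun om => (Z om * phi (X om, Y om))%:E) ->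
  (forall B, measurable B -> \int[P]_(om in X @^-1` B) (phi (X om, Y om))%:E = 0) ->
  \int[P]_om (Z om * phi (X om, Y om))%:E = 0.
Proof.
move=> mphi iphi iZphi phi0.
have indepX A B : measurable A -> measurable B ->
    P (X @^-1` A `&` Y @^-1` B) = P (X @^-1` A) * P (Y @^-1` B).
  move=> mA mB; have := indep (measurableX measurableT mA) mB.
  rewrite (_ : (fun om => (Z om, X om)) @^-1` _ = X @^-1` A)//.
  by apply/seteqP; split => om //= -[].
pose m1 : probability T1 R := distribution P X.
pose m2 : probability T2 R := distribution P Y.
(* [q x] is the mean of [phi (x, Y)]; it vanishes for almost every [x]. *)
pose q x := \int[m2]_y (phi (x, y))%:E.
have mEphi : measurable_fun setT (EFin \o phi) by exact/measurable_EFinP.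
have iprod := indep_integrable indepX mEphi iphi.
have iq : m1.-integrable setT q := integrable_fubini_F iprod.
(* By Fubini the integral of [q] over [B] is that of [phi (X, Y)] over the event [X] in [B], zero by
   hypothesis. *)
have q0 : ae_eq m1 setT q (cst 0).
  apply: integral_ae_eq => // B _ mB.
  rewrite integral0 integral_mkcond.
  have mB1 : measurable_fun setT (fun p : T1 * T2 => (\1_B p.1 * phi p)%:E).
    apply/measurable_EFinP/measurable_funM => //.
    by apply: measurableT_comp => //; exact: measurable_indic.
  have iB1 : P.-integrable setT (fun om => (\1_B (X om) * phi (X om, Y om))%:E).
    apply: le_integrable iphi => //.
      exact: (measurableT_comp mB1 (measurable_fun_pair mX mY)).
    move=> om _; rewrite lee_fin normrM ler_piMl// indicE; case: (_ \in _); rewrite ?normr1 ?normr0 ?ler01//.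
  have := indep_integral indepX mB1 iB1 => /=.
  have -> : \int[P]_om (\1_B (X om) * phi (X om, Y om))%:E = 0.
    rewrite -[RHS](phi0 B mB) [RHS]integral_mkcond; apply: eq_integral => om _.
    rewrite patchE indicE (_ : (om \in X @^-1` B) = (X om \in B)) ?inE//.
    by case: ifPn; rewrite ?mul1r ?mul0r.
  move=> <-; apply: eq_integral => x _; rewrite patchE indicE.
  case: ifPn => xB; last by under eq_integral do rewrite mul0r; rewrite integral0.
  by apply: eq_integral => y _; rewrite mul1r.
have mpsi : measurable_fun setT (fun p : (R * T1) * T2 => (p.1.1 * phi (p.1.2, p.2))%:E).
  apply/measurable_EFinP/measurable_funM; first exact: measurableT_comp.
  apply: measurableT_comp => //; apply: measurable_fun_pair => //; exact: measurableT_comp.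
rewrite -(indep_integral (X := ZX) indep mpsi iZphi)/=.
rewrite (ae_eq_integral (cst 0)) ?integral0//.
  exact: (measurable_fubini_F (indep_integrable (X := ZX) indep mpsi iZphi)).
have [N1 [mN1 N10 sN1]] := q0.
have [N2 [mN2 N20 sN2]] := ae_integrable1 iprod.
(* [N1] covers the points where [q] is nonzero, [N2] those where [phi (x, .)] is not integrable and
   [z] could not be taken out of the integral. *)
exists ((fun p : R * T1 => p.2) @^-1` (N1 `|` N2)); split.
- by rewrite -[X in measurable X]setTI; apply: measurable_snd => //; exact: measurableU.
- apply/eqP; rewrite eq_le measure_ge0 andbT.
  apply: (@le_trans _ _ (m1 (N1 `|` N2))); first by [].
  apply: (le_trans (measureU2 _ _ _)) => //.
  rewrite -[leRHS]adde0; apply: leeD; first by rewrite -[leRHS]N10.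
  by rewrite -[leRHS]N20.
- move=> [z x] /= h; apply: contrapT => /not_orP[n1 n2]; apply: h => _.
  have qx : q x = 0 by apply: contrapT => qx; apply: n1; apply: sN1 => /(_ I).
  have ix : m2.-integrable setT (fun y => (phi (x, y))%:E).
    by apply: contrapT => ix; apply: n2; exact: sN2.
  under eq_integral do rewrite EFinM.
  by rewrite integralZl// -/m2 -/(q x) qx mule0.
Qed.
End orthogonality.

(** * Square-integrable random vectors *)

(** The set where [v k <= b + eps] belongs to the filter, so the supremum of [u] over it bounds the
    upper limit. *)
Lemma limn_esup_le_lim {R : realType} (u : nat -> \bar R) (v : nat -> R) (b : R) :
  (forall k, (u k <= (v k)%:E)%E) -> v @ \oo --> b -> (limn_esup u <= b%:E)%E.
Proof.
move=> uv vb; apply/lee_addgt0Pr => eps eps0.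
rewrite /limn_esup limf_esupE.
pose V := [set k | v k <= b + eps].
have VF : \oo V by apply: (@cvgr_le _ _ _ _ v b vb); rewrite ltrDl.
apply: (@le_trans _ _ (ereal_sup (u @` V))).
  by apply: ereal_inf_lbound; exists V.
apply: ge_ereal_sup => _ [k Vk <-].
by apply: le_trans (uv k) _; rewrite -EFinD lee_fin.
Qed.

Section square_integrable.
Context d (T : measurableType d) (R : realType) (P : probability T R).
Implicit Types h : T -> R.

Definition rintegrable (h : T -> R) := P.-integrable setT (fun x => (h x)%:E).

(** Measurability of [h] is a separate clause because that of its square does not imply it. *)
Definition sqintegrable (h : T -> R) :=
  measurable_fun setT h /\ rintegrable (fun x => h x ^+ 2).

Lemma rintegrable_meas h : rintegrable h -> measurable_fun setT h.
Proof. by move=> /measurable_int/measurable_EFinP. Qed.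

Lemma rintegrableD (h1 h2 : T -> R) : rintegrable h1 -> rintegrable h2 ->
  rintegrable (fun x => h1 x + h2 x).
Proof. exact: integrableD. Qed.

Lemma rintegrableZ k h : rintegrable h -> rintegrable (fun x => k * h x).
Proof. exact: integrableZl. Qed.

Lemma rintegrable_cst c : rintegrable (fun=> c).
Proof. exact: finite_measure_integrable_cst. Qed.

Lemma rintegrable_sum I (s : seq I) (h : I -> T -> R) :
  (forall i, rintegrable (h i)) -> rintegrable (fun x => \sum_(i <- s) h i x).
Proof.
move=> hi; rewrite /rintegrable; under eq_fun do rewrite -sumEFin.
by apply: integrable_sum => // i _; exact: hi.
Qed.

Lemma rintegrable_le (h1 h2 : T -> R) : measurable_fun setT h1 ->
  (forall x, `|h1 x| <= h2 x) -> rintegrable h2 -> rintegrable h1.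
Proof.
move=> m1 h12 i2; apply: le_integrable i2 => //; first exact/measurable_EFinP.
by move=> x _; rewrite lee_fin (le_trans (h12 x))// ler_norm.
Qed.

Lemma sqintegrable_cst c : sqintegrable (fun=> c).
Proof. by split => //; exact: rintegrable_cst. Qed.

Lemma sqintegrableZ k h : sqintegrable h -> sqintegrable (fun x => k * h x).
Proof.
move=> [mh ih]; split; first exact: measurable_funM.
by under eq_fun do rewrite exprMn; exact: rintegrableZ.
Qed.

Lemma sqintegrableD (h1 h2 : T -> R) : sqintegrable h1 -> sqintegrable h2 ->
  sqintegrable (fun x => h1 x + h2 x).
Proof.
move=> [m1 i1] [m2 i2].
have m12 : measurable_fun setT (fun x => h1 x + h2 x) by exact: measurable_funD.
split => //.
apply: (rintegrable_le _ _ (rintegrableD (rintegrableZ 2 i1) (rintegrableZ 2 i2))).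
  exact: measurable_funX.
move=> x; rewrite ger0_norm ?sqr_ge0//; have := sqr_ge0 (h1 x - h2 x); nra.
Qed.

Lemma sqintegrable_sum I (s : seq I) (h : I -> T -> R) :
  (forall i, sqintegrable (h i)) -> sqintegrable (fun x => \sum_(i <- s) h i x).
Proof.
move=> hi; elim: s => [|i s IH].
  by under eq_fun do rewrite big_nil; exact: sqintegrable_cst.
by under eq_fun do rewrite big_cons; exact: sqintegrableD.
Qed.

Lemma sqintegrableM (h1 h2 : T -> R) : sqintegrable h1 -> sqintegrable h2 ->
  rintegrable (fun x => h1 x * h2 x).
Proof.
move=> [m1 i1] [m2 i2].
apply: (rintegrable_le _ _ (rintegrableD i1 i2)); first exact: measurable_funM.
move=> x; rewrite ler_norml; have := sqr_ge0 (h1 x - h2 x).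
have := sqr_ge0 (h1 x + h2 x); nra.
Qed.

Lemma sqintegrable_rintegrable h : sqintegrable h -> rintegrable h.
Proof.
move=> /(sqintegrableM (sqintegrable_cst 1)).
by rewrite /rintegrable; under eq_fun do rewrite mul1r.
Qed.

Lemma sqintegrable_le (h1 h2 : T -> R) : measurable_fun setT h1 ->
  (forall x, h1 x ^+ 2 <= h2 x) -> rintegrable h2 -> sqintegrable h1.
Proof.
move=> m1 h12 i2; split => //; apply: (rintegrable_le _ _ i2).
  exact: measurable_funX.
by move=> x; rewrite ger0_norm ?sqr_ge0.
Qed.

Lemma measurable_dotv n (x y : T -> 'cV[R]_n) :
  (forall j, measurable_fun setT (fun t => x t j 0)) ->
  (forall j, measurable_fun setT (fun t => y t j 0)) ->
  measurable_fun setT (fun t => dotv (x t) (y t)).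
Proof.
move=> mx my; under eq_fun do rewrite dotvE.
by apply: measurable_sum => j; apply: measurable_funM.
Qed.

Lemma rintegrable_dotv n (x y : T -> 'cV[R]_n) :
  (forall j, sqintegrable (fun t => x t j 0)) ->
  (forall j, sqintegrable (fun t => y t j 0)) ->
  rintegrable (fun t => dotv (x t) (y t)).
Proof.
move=> ix iy; rewrite /rintegrable; under eq_fun do rewrite dotvE.
by apply: rintegrable_sum => j; exact: sqintegrableM.
Qed.

Lemma integral_dotv n (x y : T -> 'cV[R]_n) :
  (forall j, sqintegrable (fun t => x t j 0)) ->
  (forall j, sqintegrable (fun t => y t j 0)) ->
  (\int[P]_t (dotv (x t) (y t))%:E = \sum_j \int[P]_t (x t j 0 * y t j 0)%:E)%E.
Proof.
move=> ix iy; under eq_integral do rewrite dotvE -sumEFin.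
by rewrite integral_sum// => j; exact: sqintegrableM.
Qed.

Lemma integral_rcst (c : R) : (\int[P]_t c%:E = c%:E)%E.
Proof. by rewrite integral_cst//= probability_setT mule1. Qed.

Lemma integral_rD (h1 h2 : T -> R) : rintegrable h1 -> rintegrable h2 ->
  (\int[P]_t (h1 t + h2 t)%:E = \int[P]_t (h1 t)%:E + \int[P]_t (h2 t)%:E)%E.
Proof. by move=> i1 i2; exact: (integralD_EFin _ i1 i2). Qed.

Lemma integral_rZ (k : R) h : rintegrable h ->
  (\int[P]_t (k * h t)%:E = k%:E * \int[P]_t (h t)%:E)%E.
Proof. by move=> i1; rewrite -integralZl. Qed.

(** Replacing [h] by [min h c], equal to it almost everywhere, makes the bound pointwise. *)
Lemma integral_ae_le_cst h c : rintegrable h -> {ae P, forall x, h x <= c} ->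
  (\int[P]_x (h x)%:E <= c%:E)%E.
Proof.
move=> ih hc.
rewrite (ae_eq_integral (fun x => (Num.min (h x) c)%:E)) //.
- rewrite -[leRHS]integral_rcst; apply: le_integral => //.
  + apply: (rintegrable_le (h2 := fun x => `|h x| + `|c|)).
    * by apply: measurable_minr => //; exact: rintegrable_meas.
    * by move=> x; rewrite minEle; case: ifP => _; rewrite ?lerDl ?lerDr.
    * by apply: rintegrableD; [exact: integrable_norm|exact: rintegrable_cst].
  + exact: rintegrable_cst.
  + by move=> x _; rewrite lee_fin ge_min lexx orbT.
- exact: measurable_int ih.
- apply/measurable_EFinP/measurable_minr => //; exact: rintegrable_meas.
- by apply: filterS hc => x hx _; rewrite minEle hx.
Qed.

(** With [m] the mean, [E|x - m|^2 = E|x - c|^2 - |m - c|^2]. With [c = xinf] the variance inherits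
    the mean-square bound. *)
Lemma Var_le_sqnorm n (x : T -> 'cV[R]_n) (c : 'cV[R]_n) :
  (forall j, sqintegrable (fun t => x t j 0)) ->
  (Var P x <= 'E_P[fun t => sqnorm (x t - c)])%E.
Proof.
move=> ix; rewrite /Var unlock; set m := mean_vec P x.
have ixc j a : sqintegrable (fun t => (x t - a) j 0).
  by under eq_fun do rewrite !mxE; apply: sqintegrableD => //; exact: sqintegrable_cst.
have icst (a : 'cV[R]_n) j : sqintegrable (fun t : T => a j 0) by exact: sqintegrable_cst.
have mE : (\int[P]_t (dotv (m - c) (x t - c))%:E = (sqnorm (m - c))%:E)%E.
  rewrite integral_dotv// sqnormE -sumEFin; apply: eq_bigr => j _.
  under eq_integral do rewrite EFinM.
  rewrite integralZl//; last exact: sqintegrable_rintegrable.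
  rewrite expr2 EFinM; congr (_ * _)%E.
  under eq_integral do rewrite !mxE.
  rewrite (integralB_EFin (f1 := fun t => x t j 0) (f2 := fun=> c j 0))//; last 2 first.
    exact: sqintegrable_rintegrable. exact: rintegrable_cst.
  rewrite integral_rcst !mxE unlock EFinB fineK//.
  by apply: integrable_fin_num => //; exact: sqintegrable_rintegrable.
have -> : (fun t => (sqnorm (x t - m))%:E) =
   (fun t => (sqnorm (x t - c) + (-2 * dotv (m - c) (x t - c) + sqnorm (m - c)))%:E)%E.
  apply/funext => t; congr EFin.
  rewrite -[x t - m](subrK (c - c)).
  have -> : x t - m - (c - c) + (c - c) = (x t - c) - (m - c).
    by apply/colP => i; rewrite !mxE; ring.
  rewrite /sqnorm !(dotvDl (x t - c)) !(dotvDr _ (x t - c)) !(dotvNl (m - c)) !(dotvNr _ (m - c)) (dotvC (x t - c) (m - c)); ring.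
have iS : rintegrable (fun t => sqnorm (x t - c)) by exact: rintegrable_dotv.
have iD : rintegrable (fun t => dotv (m - c) (x t - c)) by exact: rintegrable_dotv.
rewrite integral_rD//; last first.
  by apply: rintegrableD; [exact: rintegrableZ|exact: rintegrable_cst].
rewrite integral_rD//; [|exact: rintegrableZ|exact: rintegrable_cst].
rewrite integral_rZ// mE integral_rcst -EFinM -EFinD -[leRHS]adde0 leeD2l// lee_fin.
have := sqnorm_ge0 (m - c); lra.
Qed.
End square_integrable.

(** * Measurability and square integrability of gradient fields *)

Section gradient_measurable.
Context {R : realType}.

Lemma coord_sqr_le n (x : 'cV[R]_n) j : x j 0 ^+ 2 <= sqnorm x.
Proof.
by rewrite sqnormE (bigD1 j)//= lerDl sumr_ge0// => i _; exact: sqr_ge0.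
Qed.

(** Compares with the sup norm, which carries the topology; the crude factor [n] is enough for
    continuity. *)
Lemma enorm_le_norm n (x : 'cV[R]_n) : enorm x <= n%:R * `|x|.
Proof.
rewrite -(@ler_pXn2r _ 2)// ?nnegrE ?enorm_ge0 ?mulr_ge0//.
rewrite enorm_sqr sqnormE exprMn.
apply: (@le_trans _ _ (\sum_(j < n) `|x| ^+ 2)).
  apply: ler_sum => j _; rewrite -[x j 0 ^+ 2]real_normK ?num_real//.
  rewrite lerXn2r ?nnegrE// [leRHS]mx_normrE.
  exact: (le_bigmax _ (fun ij => `|x ij.1 ij.2|) (j, 0)).
rewrite sumr_const card_ord -[leLHS]mulr_natl ler_wpM2r ?sqr_ge0//.
by rewrite -natrX ler_nat; case: n {x} => // n; rewrite leq_pmull.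
Qed.

Lemma grad_coord_continuous n (L : R) (f : 'cV[R]_n -> R) j : 0 <= L ->
  lipschitz_gradient L f -> continuous (fun x => grad f x j 0).
Proof.
move=> L0 [_ lf] x; have nx : Filter (nbhs x) := nbhs_filter x.
apply/cvgrPdist_le => eps eps0.
(* The added 1 keeps the divisor positive even if [L] or [n] vanishes. *)
have M0 : 0 < L * n%:R + 1 by rewrite ltr_wpDl ?mulr_ge0.
near=> t.
apply: (@le_trans _ _ (enorm (grad f x - grad f t))).
  rewrite -(@ler_pXn2r _ 2)// ?nnegrE ?enorm_ge0// real_normK ?num_real// enorm_sqr.
  by have := coord_sqr_le (grad f x - grad f t) j; rewrite !mxE.
apply: le_trans (lf _ _) _.
apply: (@le_trans _ _ (L * (n%:R * `|x - t|))); first by rewrite ler_wpM2l// enorm_le_norm.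
have xt : `|x - t| <= eps / (L * n%:R + 1).
  by near: t; apply: cvgr_dist_le; [exact: cvg_id|rewrite divr_gt0].
rewrite mulrA; apply: (@le_trans _ _ ((L * n%:R + 1) * `|x - t|)).
  by rewrite ler_wpM2r// lerDl.
by rewrite mulrC -ler_pdivlMr.
Unshelve. all: by end_near.
Qed.
End gradient_measurable.

Section fields.
Context {R : realType} {N d : nat}.
Variables (f : 'I_N -> 'cV[R]_d -> R) (L : R).
Hypothesis hL0 : 0 <= L.
Hypothesis hL : forall i, lipschitz_gradient L (f i).

Lemma measurable_grad i j :
  measurable_fun setT (fun x : borel_cV R d => grad (f i) x j 0).
Proof.
apply: continuous_measurable_cV.
exact: (grad_coord_continuous hL0 (hL i)).
Qed.

(** An affine combination of [y], its penalized gradient and [x], so that measurability and square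
    integrability follow from closure under linear operations. *)
Lemma noise_dirE W (lam : N.-tuple R) al be (Pt : 'M[R]_2) xinf (x xm : 'cV[R]_(N * d)) p :
  let K := (1 - lam`_N.-1 + al * L) / (2 * al) in
  noise_dir f W lam al be L Pt xinf x xm p 0 =
    - (2 * al) * Pt 0 0 * extrapolate be (x, xm) p 0 +
    (2 * K * al ^+ 2 - al + 2 * al ^+ 2 * Pt 0 0) *
      pen_grad f W al (extrapolate be (x, xm)) p 0 +
    - (2 * al) * Pt 0 1 * x p 0 + 2 * al * (Pt 0 0 + Pt 0 1) * xinf p 0.
Proof.
rewrite /noise_dir; set y := extrapolate be _; set g := pen_grad _ _ _ _.
by clearbody y g; rewrite !mxE; ring.
Qed.

Lemma pen_gradE W al (y : 'cV[R]_(N * d)) p :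
  pen_grad f W al y p 0 =
  stack_grad f y p 0 + al^-1 * ((1%:M - kronW W) *m y) p 0.
Proof. by rewrite /pen_grad mxE [X in _ + X]mxE. Qed.

Section measurable_fields.
Context {dT : measure_display} {T : measurableType dT}.
Implicit Types x y : T -> 'cV[R]_(N * d).
Let mcoord n (x : T -> 'cV[R]_n) := forall j, measurable_fun setT (fun t => x t j 0).

Lemma measurable_stack_grad y : mcoord y -> mcoord (fun t => stack_grad f (y t)).
Proof.
move=> my p; under eq_fun do rewrite mxE.
set i := (mxtens_unindex p).1; set l := (mxtens_unindex p).2.
have mb : measurable_fun setT (fun t => block i (y t) : borel_cV R d).
  by apply: measurable_cV => j; exact: measurable_block.
exact: (measurableT_comp (measurable_grad i l) mb).
Qed.

Lemma measurable_pen_grad (W : 'M[R]_N) al y :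
  mcoord y -> mcoord (fun t => pen_grad f W al (y t)).
Proof.
move=> my p; under eq_fun do rewrite pen_gradE.
apply: measurable_funD; first exact: measurable_stack_grad.
by apply: measurable_funM => //; exact: measurable_mulmx.
Qed.

Lemma measurable_noise_dir W lam al be (Pt : 'M[R]_2) xinf x xm :
  mcoord x -> mcoord xm ->
  mcoord (fun t => noise_dir f W lam al be L Pt xinf (x t) (xm t)).
Proof.
move=> mx mxm p.
have my : mcoord (fun t => extrapolate be (x t, xm t)) by exact: measurable_extrapolate.
have mg := measurable_pen_grad W al my.
under eq_fun do rewrite noise_dirE.
by repeat (apply: measurable_funD => //; try apply: measurable_funM => //).
Qed.

Lemma measurable_quad (A : 'M[R]_(N * d)) x :
  mcoord x -> measurable_fun setT (fun t => ((x t)^T *m A *m x t) 0 0).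
Proof.
move=> mx; under eq_fun do rewrite quadE.
apply: measurable_sum => i; apply: measurable_sum => j.
by apply: measurable_funM => //; apply: measurable_funM.
Qed.

Lemma measurable_penalized (W : 'M[R]_N) al x :
  mcoord x -> measurable_fun setT (fun t => penalized W al f (x t)).
Proof.
move=> mx; rewrite /penalized; apply: measurable_funD.
  by apply: measurable_funM => //; exact: measurable_quad.
apply: measurable_sum => i.
have mf : measurable_fun setT (f i : borel_cV R d -> R).
  apply: continuous_measurable_cV => z.
  by apply: differentiable_continuous; exact: (hL i).1.
have mb : measurable_fun setT (fun t => block i (x t) : borel_cV R d).
  by apply: measurable_cV => j; exact: measurable_block.
exact: (measurableT_comp mf mb).
Qed.

Lemma measurable_Vfun (W : 'M[R]_N) al Pt xinf x xm :
  mcoord x -> mcoord xm ->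
  measurable_fun setT (fun t => Vfun f W al Pt xinf (x t) (xm t)).
Proof.
move=> mx mxm.
have mB z : mcoord z -> mcoord (fun t => z t - xinf).
  by move=> mz j; under eq_fun do rewrite !mxE; exact: measurable_funB.
have m1 := mB _ mx; have m2 := mB _ mxm.
rewrite /Vfun /qform2 /sqnorm; apply: measurable_funD.
  by repeat (apply: measurable_funD => //; try apply: measurable_funM => //);
    exact: measurable_dotv.
by apply: measurable_funB => //; exact: measurable_penalized.
Qed.
End measurable_fields.

Section square_integrable_fields.
Context {dT : measure_display} {T : measurableType dT}.
Variable P : probability T R.
Implicit Types x y : T -> 'cV[R]_(N * d).
Let L2coord n (x : T -> 'cV[R]_n) := forall j, sqintegrable P (fun t => x t j 0).

Lemma sqintegrable_mulmx m n (A : 'M[R]_(m, n)) (x : T -> 'cV[R]_n) :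
  L2coord x -> L2coord (fun t => A *m x t).
Proof.
move=> ix p; under eq_fun do rewrite mxE.
by apply: sqintegrable_sum => i; exact: sqintegrableZ.
Qed.

Lemma sqintegrable_extrapolate be x xm :
  L2coord x -> L2coord xm -> L2coord (fun t => extrapolate be (x t, xm t)).
Proof.
move=> ix ixm p; under eq_fun do rewrite /extrapolate -scaleNr !mxE.
by apply: sqintegrableD; exact: sqintegrableZ.
Qed.

(** A Lipschitz gradient grows at most linearly, here measured from its value at 0. *)
Lemma sqintegrable_stack_grad y :
  L2coord y -> L2coord (fun t => stack_grad f (y t)).
Proof.
move=> iy p.
have my : forall j, measurable_fun setT (fun t => stack_grad f (y t) j 0).
  by apply: measurable_stack_grad => j; exact: (iy j).1.
pose i := (mxtens_unindex p).1; pose l := (mxtens_unindex p).2.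
apply: (sqintegrable_le (h2 := fun t =>
  2 * (grad (f i) 0 l 0) ^+ 2 + 2 * L ^+ 2 * sqnorm (block i (y t)))) => //.
- move=> t; rewrite mxE -/i -/l.
  have := (hL i).2 (block i (y t)) 0; rewrite subr0 => h.
  have h2 := coord_sqr_le (grad (f i) (block i (y t)) - grad (f i) 0) l.
  have h3 : sqnorm (grad (f i) (block i (y t)) - grad (f i) 0) <=
      L ^+ 2 * sqnorm (block i (y t)).
    by rewrite -!enorm_sqr -exprMn lerXn2r// nnegrE ?enorm_ge0// mulr_ge0// enorm_ge0.
  have := le_trans h2 h3; rewrite mxE [X in _ + X]mxE.
  set u := grad _ _ l 0; set v := grad _ _ l 0; set S := sqnorm _.
  (* [u^2 = 2 v^2 + 2 (u - v)^2 - (u - 2 v)^2]. *)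
  have := sqr_ge0 (u - v - v); nra.
- apply: rintegrableD; first exact: rintegrable_cst.
  apply: rintegrableZ; apply: rintegrable_dotv => j; under eq_fun do rewrite mxE; exact: iy.
Qed.

Lemma sqintegrable_noise_dir W lam al be (Pt : 'M[R]_2) xinf x xm :
  L2coord x -> L2coord xm ->
  L2coord (fun t => noise_dir f W lam al be L Pt xinf (x t) (xm t)).
Proof.
move=> ix ixm p; under eq_fun do rewrite noise_dirE pen_gradE.
have iy := sqintegrable_extrapolate be ix ixm.
have ig := sqintegrable_stack_grad iy.
have il := sqintegrable_mulmx (1%:M - kronW W) iy.
apply: sqintegrableD; last exact: sqintegrable_cst.
apply: sqintegrableD; last exact: sqintegrableZ.
apply: sqintegrableD; first exact: sqintegrableZ.
apply: sqintegrableZ; apply: sqintegrableD => //; exact: sqintegrableZ.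
Qed.
End square_integrable_fields.
End fields.

(** * The stochastic recursion *)

Lemma qform2_ge0 {R : realType} (Pt : 'M[R]_2) n (a b : 'cV[R]_n) :
  psdmx Pt -> 0 <= qform2 Pt a b.
Proof.
move=> [Ps P0]; rewrite /qform2 !sqnormE dotvE !mulr_sumr -!big_split/=.
apply: sumr_ge0 => j _.
pose v : 'cV[R]_2 := mx_of_rows 2 1 [:: [:: a j 0]; [:: b j 0]].
by have := P0 v; rewrite quad2// !mxE.
Qed.

Lemma psdmx_diag_ge0 {R : realType} n (A : 'M[R]_n) i : psdmx A -> 0 <= A i i.
Proof.
case=> _ /(_ (delta_mx i 0)).
by rewrite trmx_delta -rowE -colE !mxE.
Qed.

Section cond_exp.
Context {dO : measure_display} {Omega : measurableType dO} {R : realType}.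
Variable P : probability Omega R.

(** Tested on the whole space, a conditional expectation keeps the integral, so the conditional
    bound becomes unconditional. *)
Lemma cond_exp_le_integral (G : set (set Omega)) (X : Omega -> R) c :
  G setT -> cond_exp_le P G X c ->
  rintegrable P X /\ (\int[P]_om (X om)%:E <= c%:E)%E.
Proof.
move=> GT [Z [[iX iZ _ XZ] Zc]]; split; first exact: iX.
by rewrite XZ//; exact: integral_ae_le_cst.
Qed.
End cond_exp.

(** * The gradient noise along the iterates *)

Section noise_process.
Context {R : realType} {N d : nat}.
Context {dO : measure_display} {Omega : measurableType dO}.
Context {dS : 'I_N -> measure_display} {S : forall i, measurableType (dS i)}.
Variables (P : probability Omega R) (f : 'I_N -> 'cV[R]_d -> R) (L sigma : R).
Hypothesis hL0 : 0 <= L.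
Hypothesis hL : forall i, lipschitz_gradient L (f i).
Variables (w : nat -> forall i : 'I_N, Omega -> S i).
Hypothesis hwm : forall k i, measurable_fun setT (w k i).
Hypothesis hwi : noise_independent P w.
Variable g : forall i : 'I_N, 'cV[R]_d -> S i -> 'cV[R]_d.
Hypothesis hg : oracle_measurable g.
Variable y : nat -> Omega -> 'cV[R]_(N * d).
Hypothesis hmom : noise_moments P w f g sigma y.

Definition grad_noise k om : 'cV[R]_(N * d) :=
  stoch_grad w g om k (y k om) - stack_grad f (y k om).

Lemma grad_noiseE k om p :
  grad_noise k om p 0 =
  g (block (mxtens_unindex p).1 (y k om)) (w k (mxtens_unindex p).1 om) (mxtens_unindex p).2 0
  - grad (f (mxtens_unindex p).1) (block (mxtens_unindex p).1 (y k om)) (mxtens_unindex p).2 0.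
Proof. by rewrite !mxE. Qed.

Lemma block_grad_noise k om i :
  block i (grad_noise k om) =
  g (block i (y k om)) (w k i om) - grad (f i) (block i (y k om)).
Proof. by rewrite /grad_noise blockD blockN !block_stack. Qed.

Lemma integral_sqnorm_grad_noise k :
  rintegrable P (fun om => sqnorm (grad_noise k om)) /\
  (\int[P]_om (sqnorm (grad_noise k om))%:E <= (sigma ^+ 2 * N%:R)%:E)%E.
Proof.
have H i : rintegrable P (fun om => sqnorm (block i (grad_noise k om))) /\
    (\int[P]_om (sqnorm (block i (grad_noise k om)))%:E <= (sigma ^+ 2)%:E)%E.
  under eq_fun do rewrite block_grad_noise.
  under eq_integral do rewrite block_grad_noise.
  apply: cond_exp_le_integral (hmom k i).2.
  by exists setT => //; rewrite setTI preimage_setT.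
split.
  rewrite /rintegrable; under eq_fun do rewrite sqnorm_block.
  by apply: rintegrable_sum => i; exact: (H i).1.
under eq_integral do rewrite sqnorm_block -sumEFin.
rewrite integral_sum// => [|i]; last exact: (H i).1.
apply: le_trans (lee_sum _ (fun i _ => (H i).2)) _.
by rewrite sumEFin sumr_const card_ord mulr_natr.
Qed.

Lemma measurable_grad_noise k :
  (forall j, measurable_fun setT (fun om => y k om j 0)) ->
  forall p, measurable_fun setT (fun om => grad_noise k om p 0).
Proof.
move=> my p; under eq_fun do rewrite mxE [X in _ + X]mxE.
apply: measurable_funB; last exact: (measurable_stack_grad hL0 hL).
under eq_fun do rewrite mxE.
set i := (mxtens_unindex p).1; set l := (mxtens_unindex p).2.
have mp : measurable_fun setT (fun om => (block i (y k om) : borel_cV R d, w k i om)).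
  apply: measurable_fun_pair; last exact: hwm.
  by apply: measurable_cV => l'; exact: measurable_block.
exact: (measurableT_comp (measurableT_comp (measurable_coord l) (@hg i)) mp).
Qed.

Lemma sqintegrable_grad_noise k :
  (forall j, measurable_fun setT (fun om => y k om j 0)) ->
  forall p, sqintegrable P (fun om => grad_noise k om p 0).
Proof.
move=> my p; have [iS _] := integral_sqnorm_grad_noise k.
apply: sqintegrable_le iS; first exact: measurable_grad_noise.
by move=> om; exact: coord_sqr_le.
Qed.

(* [Omega] with the sigma-algebra [other_noise w k i]. *)
Definition past_type k i := g_sigma_algebraType
  (\bigcup_(p in [set p : nat * 'I_N | (p.1 < k)%N \/ (p.1 = k /\ p.2 <> i)])
     sigma_of (w p.1 p.2)).

Lemma measurable_past k i t j : (t < k)%N ->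
  measurable_fun setT (w t j : past_type k i -> S j).
Proof.
move=> tk _ B mB; apply: sub_sigma_algebra; exists (t, j); first by left.
by exists B.
Qed.

(** Measurability is asked for twice: on [Omega] to integrate, and on [past_type k i], whose events
    are independent of [w k i]. The noise coordinate is [phi] applied to [y_i] and [w k i]. *)
Lemma integral_past_grad_noise k p (Z : Omega -> R) :
  (forall j, measurable_fun setT (fun om => y k om j 0)) ->
  (forall i j, measurable_fun setT (fun om : past_type k i => y k om j 0)) ->
  sqintegrable P Z ->
  (forall i, measurable_fun setT (Z : past_type k i -> R)) ->
  (\int[P]_om (Z om * grad_noise k om p 0)%:E = 0)%E.
Proof.
move=> my my' iZ mZ'; have ie := sqintegrable_grad_noise my p.
set i := (mxtens_unindex p).1; set l := (mxtens_unindex p).2.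
pose X om : borel_cV R d := block i (y k om).
pose phi (q : borel_cV R d * S i) := g q.1 q.2 l 0 - grad (f i) q.1 l 0.
have mX : measurable_fun setT X.
  by apply: measurable_cV => j; exact: measurable_block.
have mphi : measurable_fun setT phi.
  apply: measurable_funB.
    exact: (measurableT_comp (measurable_coord l) (@hg i)).
  exact: (measurableT_comp (measurable_grad hL0 hL i l) measurable_fst).
have phiE om : phi (X om, w k i om) = grad_noise k om p 0 by rewrite grad_noiseE.
under eq_integral do rewrite -phiE.
apply: (indep_orthogonal (X := X) (Y := w k i)) => //.
- exact: iZ.1.
- move=> A B mA mB.
  have := hwi (k := k) (i := i) (A := w k i @^-1` B)
    (B := (fun om => (Z om, X om)) @^-1` A).
  rewrite setIC [RHS in _ -> _ = RHS]muleC; apply.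
    by exists B => //; rewrite setTI.
  have mZX : measurable_fun setT (fun om : past_type k i => (Z om, X om)).
    apply: measurable_fun_pair => //.
    by apply: measurable_cV => j; apply: measurable_block.
  by have := mZX measurableT A mA; rewrite setTI.
- under eq_fun do rewrite phiE; exact: sqintegrable_rintegrable.
- by under eq_fun do rewrite phiE; exact: sqintegrableM.
(* The event [y_i] in [B] lies in the sigma-algebra conditioned on, so the oracle and the gradient
   have the same integral over it. *)
- move=> B mB; have [+ _] := hmom k i => /(_ l)[ig iG _ gG].
  rewrite /phi/=.
  have GA : sigma_of X (X @^-1` B) by exists B => //; rewrite setTI.
  have mXB : measurable (X @^-1` B) by rewrite -[X in measurable X]setTI; exact: mX.
  rewrite (integralB_EFin (f1 := fun om => g (X om) (w k i om) l 0)
     (f2 := fun om => grad (f i) (X om) l 0))//.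
  + rewrite (gG _ GA) subee//; apply: integrable_fin_num => //.
    exact: (integrableS measurableT).
  + exact: (integrableS measurableT).
  + exact: (integrableS measurableT).
Qed.
End noise_process.

Theorem theorem5 (R : realType) (N d : nat) (hN : (0 < N)%N)
  (mu L : R) (hmu : 0 < mu) (hmuL : mu <= L)
  (f : 'I_N -> 'cV[R]_d -> R)
  (hsc : forall i, strongly_convex mu (f i))
  (hL : forall i, lipschitz_gradient L (f i))
  (e : rel 'I_N) (he : connected_graph e)
  (W : 'M[R]_N) (hW : mixing_matrix e W)
  (lam : N.-tuple R) (hlam : ordered_spectrum W lam)
  (hlamN : 0 < lam`_N.-1)
  (dO : measure_display) (Omega : measurableType dO) (P : probability Omega R)
  (dS : 'I_N -> measure_display) (S : forall i, measurableType (dS i))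
  (w : nat -> forall i : 'I_N, Omega -> S i)
  (hwm : forall k i, measurable_fun setT (w k i))
  (hwi : noise_independent P w)
  (g : forall i : 'I_N, 'cV[R]_d -> S i -> 'cV[R]_d)
  (hg : oracle_measurable g)
  (al be : R) (hal : 0 < al) (hbe : 0 <= be)
  (x0 xm1 : 'cV[R]_(N * d))
  (sigma : R) (hsigma : 0 <= sigma)
  (hmom : noise_moments P w f g sigma (dasg_y w W al be g x0 xm1))
  (xinf : 'cV[R]_(N * d))
  (hxinf : unique_minimizer (penalized W al f) xinf)
  (rho : R) (hrho : 0 < rho < 1)
  (Pt : 'M[R]_2) (hPt : psdmx Pt)
  (hLMI : LMI al be mu L lam`_N.-1 rho Pt) :
  let x := dasg_x w W al be g x0 xm1 in
  let Pmx := Pt *t (1%:M : 'M[R]_(N * d)) in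
  let V0 := lyapunov W al f xinf Pmx 1 (xi_pair (x0 - xinf) (xm1 - xinf)) in
  let C := Pt 0 0 + (1 - lam`_N.-1 + al * L) / (2 * al) in
  (forall k : nat,
    ('E_P[fun om => sqnorm (x k om - xinf)] <=
     (rho ^+ (2 * k) * (2 * V0 / mu) +
      (1 - rho ^+ 2)^-1 * (2 * al ^+ 2 * sigma ^+ 2 * N%:R / mu) * C)%:E)%E)
  /\
  (0 < sigma ->
    (Jinf P N sigma x <= (2 * al ^+ 2 / (mu * (1 - rho ^+ 2)) * C)%:E)%E).
Proof.
move=> x Pmx V0 C.
have hL0 : 0 <= L by apply: ltW; exact: lt_le_trans hmuL.
have [r0 r1] := andP hrho.
set r := rho ^+ 2.
have r_ge0 : 0 <= r by exact: sqr_ge0.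
have r_lt1 : r < 1 by rewrite expr_lt1// ltW.
have Ps : Pt^T = Pt := hPt.1.
have hlam1 := lamN_le1 hN hW hlam.
have C0 : 0 <= C.
  rewrite addr_ge0 ?(psdmx_diag_ge0 0 hPt)// divr_ge0 ?mulr_ge0 ?(ltW hal)//.
  by rewrite addr_ge0 ?subr_ge0// mulr_ge0// ltW.
pose st om k := asg_state (kronW W : 'M[R]_(N * d)) al be (stoch_grad w g om) x0 xm1 k.
pose y := dasg_y w W al be g x0 xm1.
pose V k om := Vfun f W al Pt xinf (st om k).1 (st om k).2.
pose Z k om := noise_dir f W lam al be L Pt xinf (st om k).1 (st om k).2.
pose eps := grad_noise f w g y.
pose c := al ^+ 2 * C.
have c0 : 0 <= c by rewrite mulr_ge0// sqr_ge0.
(* Fixed point of [v -> r v + c sigma^2 N], the limit of the geometric recursion. *)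
pose B := c * (sigma ^+ 2 * N%:R) / (1 - r).
have V0E : V0 = Vfun f W al Pt xinf x0 xm1.
  by rewrite /V0 lyapunovE// /Vfun subrK.
have mst k := asg_state_measurable hg (kronW W : 'M[R]_(N * d)) al be x0 xm1
  (fun t i (_ : (t < k)%N) => hwm t i).
(* The same statement for the sigma-algebra of the other noise, which contains all noise before step
   [k]. *)
have mst' k i := asg_state_measurable hg (kronW W : 'M[R]_(N * d)) al be x0 xm1
  (fun t j (tk : (t < k)%N) => measurable_past (w := w) (i := i) (j := j) tk).
have my k : forall j, measurable_fun setT (fun om => y k om j 0).
  exact: measurable_extrapolate (fun j => (mst k j).1) (fun j => (mst k j).2).
have my' k i : forall j, measurable_fun setT (fun om : past_type w k i => y k om j 0).
  exact: measurable_extrapolate (fun j => (mst' k i j).1) (fun j => (mst' k i j).2).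
have Vge k om : mu / 2 * sqnorm ((st om k).1 - xinf) <= V k om.
  rewrite /V /Vfun -[leLHS]add0r lerD ?qform2_ge0//.
  exact: (penalized_growth hW hal hsc hL).
have V_ge0 k om : 0 <= V k om.
  by apply: le_trans (Vge k om); rewrite mulr_ge0 ?sqnorm_ge0// divr_ge0// ltW.
have mV k : measurable_fun setT (V k).
  exact: (measurable_Vfun hL _ _ _ _ (fun j => (mst k j).1) (fun j => (mst k j).2)).
have L2x k : rintegrable P (V k) ->
    forall j, sqintegrable P (fun om => (st om k).1 j 0).
  move=> iV j.
  have H : sqintegrable P (fun om => (st om k).1 j 0 - xinf j 0).
    apply: (sqintegrable_le (h2 := fun om => 2 / mu * V k om)).
    - by apply: measurable_funB => //; exact: (mst k j).1.
    - move=> om; apply: (@le_trans _ _ (sqnorm ((st om k).1 - xinf))).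
        by have := coord_sqr_le ((st om k).1 - xinf) j; rewrite !mxE.
      rewrite -ler_pdivrMl ?divr_gt0// invf_div; exact: Vge.
    - exact: rintegrableZ.
  have := sqintegrableD H (sqintegrable_cst P (xinf j 0)).
  by under eq_fun do rewrite subrK.
have step k om : V k.+1 om <= r * V k om + dotv (Z k om) (eps k om)
    + c * sqnorm (eps k om).
  have E : stack_grad f (y k om) + eps k om = stoch_grad w g om k (y k om).
    by rewrite addrC subrK.
  have := one_step hW hlam hal hL0 hsc hL hrho Ps hLMI xinf (st om k).1 (st om k).2 (eps k om).
  rewrite -[extrapolate be _]/(y k om) E; exact.
(* The induction also carries [x^(k-1)] in L^2, since the noise coefficient involves it; [x^(k)] is
   recovered from [V] by [L2x]. *)
have main k : [/\ rintegrable P (V k),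
    (\int[P]_om (V k om)%:E <= (r ^+ k * V0 + B)%:E)%E &
    forall j, sqintegrable P (fun om => (st om k).2 j 0)].
  elim: k => [|k [iV hV ixm]].
    split.
    - exact: (rintegrable_cst P (Vfun f W al Pt xinf x0 xm1)).
    - have -> : (\int[P]_om (V 0 om)%:E = V0%:E)%E.
        by rewrite V0E; exact: (integral_rcst P (Vfun f W al Pt xinf x0 xm1)).
      rewrite lee_fin expr0 mul1r lerDl.
      by rewrite divr_ge0 ?subr_ge0 ?(ltW r_lt1)// mulr_ge0// mulr_ge0// sqr_ge0.
    - by move=> j; exact: (sqintegrable_cst P (xm1 j 0)).
  have ix := L2x k iV.
  have iZ := sqintegrable_noise_dir hL0 hL W lam al be Pt xinf ix ixm.
  have ie : forall j, sqintegrable P (fun om => eps k om j 0).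
    exact: (sqintegrable_grad_noise hL0 hL hwm hg hmom (my k)).
  have iD : rintegrable P (fun om => dotv (Z k om) (eps k om)) by exact: rintegrable_dotv.
  have D0 : (\int[P]_om (dotv (Z k om) (eps k om))%:E = 0)%E.
    rewrite integral_dotv// big1// => p _.
    apply: (integral_past_grad_noise hL0 hL hwm hwi hg hmom) => //.
    move=> i.
    exact: (measurable_noise_dir hL0 hL W lam al be Pt xinf
      (fun j => (mst' k i j).1) (fun j => (mst' k i j).2)).
  have [iS S0] := integral_sqnorm_grad_noise hmom k.
  have iR : rintegrable P (fun om => r * V k om + dotv (Z k om) (eps k om)
      + c * sqnorm (eps k om)).
    by apply: rintegrableD; [apply: rintegrableD => //; exact: rintegrableZ|exact: rintegrableZ].
  (* [V] is nonnegative and dominated by an integrable function, so integrability passes to the next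
     step. *)
  have iV' : rintegrable P (V k.+1).
    by apply: rintegrable_le iR => // om; rewrite ger0_norm.
  split => //.
  apply: (@le_trans _ _ (\int[P]_om (r * V k om + dotv (Z k om) (eps k om)
      + c * sqnorm (eps k om))%:E)%E).
    by apply: le_integral => // om _; rewrite lee_fin.
  rewrite integral_rD//; [|by apply: rintegrableD => //; exact: rintegrableZ|exact: rintegrableZ].
  rewrite integral_rD//; last exact: rintegrableZ.
  rewrite !integral_rZ// D0 adde0.
  apply: (@le_trans _ _ (r%:E * (r ^+ k * V0 + B)%:E + c%:E * (sigma ^+ 2 * N%:R)%:E)%E).
    by apply: leeD; apply: lee_wpmul2l; rewrite ?lee_fin.
  rewrite -!EFinM -EFinD lee_fin /B (exprS r k).
  have r1' : 1 - r != 0 by rewrite subr_eq0 eq_sym lt_eqF.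
  by rewrite le_eqVlt; apply/orP; left; apply/eqP; field.
have bound k : ('E_P[fun om => sqnorm (x k om - xinf)] <=
     (r ^+ k * (2 * V0 / mu) +
      (1 - r)^-1 * (2 * al ^+ 2 * sigma ^+ 2 * N%:R / mu) * C)%:E)%E.
  have [iV hV _] := main k; rewrite unlock.
  apply: (@le_trans _ _ (\int[P]_om (2 / mu * V k om)%:E)%E).
    apply: le_integral => //.
    - apply: (rintegrable_le (h2 := fun om => 2 / mu * V k om)).
      + apply: measurable_dotv => j; under eq_fun do rewrite !mxE;
          by apply: measurable_funB => //; exact: (mst k j).1.
      + by move=> om; rewrite ger0_norm ?sqnorm_ge0// -ler_pdivrMl ?divr_gt0// invf_div; exact: Vge.
      + exact: rintegrableZ.
    - exact: rintegrableZ.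
    - by move=> om _; rewrite lee_fin -ler_pdivrMl ?divr_gt0// invf_div; exact: Vge.
  rewrite integral_rZ//; apply: le_trans (lee_wpmul2l _ hV) _.
    by rewrite lee_fin divr_ge0// ltW.
  rewrite -EFinM lee_fin /B /c le_eqVlt; apply/orP; left; apply/eqP; field.
  by rewrite subr_eq0 eq_sym lt_eqF//= gt_eqF.
split=> [k|sigma0].
  by rewrite exprM; exact: bound.
set b := (1 - r)^-1 * (2 * al ^+ 2 * sigma ^+ 2 * N%:R / mu) * C in bound *.
have lim : (fun k => r ^+ k * (2 * V0 / mu) + b) @ \oo --> b.
  rewrite -[X in _ --> X]add0r -[X in X + _](mul0r (2 * V0 / mu)).
  apply: cvgD; last exact: cvg_cst.
  by apply: cvgMl; apply: cvg_expr; rewrite ger0_norm.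
(* The deterministic point [xinf] takes the place of the mean. *)
have VarLe k : (Var P (x k) <= (r ^+ k * (2 * V0 / mu) + b)%:E)%E.
  apply: le_trans (bound k); apply: Var_le_sqnorm; apply: L2x.
  by have [] := main k.
have := limn_esup_le_lim VarLe lim => H.
rewrite /Jinf; apply: le_trans (lee_wpmul2l _ H) _.
  by rewrite lee_fin invr_ge0 mulr_ge0// sqr_ge0.
rewrite -EFinM lee_fin /b le_eqVlt; apply/orP; left; apply/eqP; field.
by rewrite subr_eq0 eq_sym lt_eqF//= !gt_eqF// ltr0n.
Qed.
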